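(* Suppose $T\in\mathrm{Str}(n)$ is a string link obtained as the closure of a braid $b\in B_{n+m}$, and write the Burau matrix of $b$ in block form $$\mathcal B_{n+m}(b)=\begin{bmatrix}X&Y\\ Z&Q\end{bmatrix}$$ with $X$ of size $n\times n$ and $Q$ of size $m\times m$. Then $\mathbf 1-Q$ is invertible over $\mathbb Q(t)$ and $$\mathcal R_n(T)=X+Y(\mathbf 1-Q)^{-1}Z .$$
   Context: Tangles and string links. Tangles are oriented tangles in $\mathbb R\times[0,1]$ (presented by diagrams, up to isotopy and Reidemeister moves). A tangle $T:\iota^n\to\iota^n$ has bottom endpoints $(1,0),\dots,(n,0)$ and top endpoints $(1,1),\dots,(n,1)$, with the strands oriented upwards at all endpoints. A string link on $n$ strands is a tangle $\iota^n\to\iota^n$ consisting of precisely $n$ interval components (and no closed components), each having one endpoint at the bottom and the other at the top (the permutation of endpoints is arbitrary). String links form a monoid $\mathrm{Str}(n)$ under stacking ($T\circ S$ is $T$ on top of $S$), containing the braid group $B_n$. The generator $\sigma_i\in B_n$ is the positive crossing (both strands upwards) in which the overcrossing strand goes from bottom position $i$ to top position $i+1$ and the undercrossing strand from bottom position $i+1$ to top position $i$. The (partial) closure of a braid $b\in B_{n+m}$ is the tangle $\iota^n\to\iota^n$ obtained by connecting, for $j=n+1,\dots,n+m$, the top endpoint of $b$ at position $j$ to its bottom endpoint at position $j$ by disjoint arcs passing to the right of $b$. Burau representation. $\mathcal B_N:B_N\to\mathrm{GL}_N(\mathbb Z[t,t^{-1}])$ is the (unreduced Burau) homomorphism $\sigma_i\mapsto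 \mathbf 1_{i-1}\oplus\begin{bmatrix}1-t&1\\ t&0\end{bmatrix}\oplus\mathbf 1_{N-i-1}$. Random walk invariant $\mathcal R_n$ (Lin–Tian–Wang). An admissible path in a diagram of $T\in\mathrm{Str}(n)$ starts at a bottom point $(i,0)$, ends at a top point $(j,1)$, and follows the diagram along its orientation. When it reaches a crossing along the undercrossing piece, it must continue along that piece. When it reaches a crossing along the overcrossing piece, it may either continue along it or switch to the undercrossing piece and continue in the direction of the latter. Crossings may be passed repeatedly. The weight $w(P)$ of an admissible path $P$ is the product over all crossing passages (with repetition) of: $1$ if the crossing is approached along the undercrossing piece; $t$ if the crossing is positive, approached along the overcrossing piece, and $P$ continues along it; $1-t$ if the crossing is positive, approached along the overcrossing piece, and $P$ switches; $t^{-1}$, respectively $1-t^{-1}$, in the corresponding cases for a negative crossing. $\mathcal R_n(T)$ is the $n\times n$ matrix with $(j,i)$ entry $\mathcal R_n(T)_{j,i}=\sum_P w(P)$, summing over all admissible paths $P$ from $(i,0)$ to $(j,1)$ ($0$ if there are none). For $t$ sufficiently close to $1$ the sums converge to rational functions of $t$, independent of the diagram (Lin–Tian–Wang), so $\mathcal R_n(T)$ is a matrix over $\mathbb Q(t)$. *)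

(* Defs.v *)
(* MathComp / MathComp-Analysis. *)
From Stdlib Require Import Relation_Operators.
From HB Require Import structures.
From mathcomp Require Import all_boot all_order all_algebra.
From mathcomp Require Import fraction.
From mathcomp Require Import all_classical all_reals all_analysis.

Set Implicit Arguments.
Unset Strict Implicit.
Unset Printing Implicit Defensive.

Import Order.TTheory GRing.Theory Num.Theory.
Import numFieldNormedType.Exports.

Local Open Scope ring_scope.

(** * Oriented tangle diagrams

   A diagram is cut by horizontal lines into slices, listed from bottom to top,
   each containing one crossing, minimum or maximum and otherwise vertical
   strands.  A slice [(i, t)] is the tile [t] with [i] vertical strands on its
   left.  The strands cut by a horizontal line, from left to right, form a
   [seq bool]: [true] for a strand oriented upwards, [false] for downwards.

   [Cross k]: of the two strands, the one going from the lower left to the upper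
   right is the overcrossing one if [k], the undercrossing one otherwise.
   [Cup d]: a minimum, whose left leg is oriented upwards iff [d].
   [Cap]: a maximum. *)

Inductive tile : Type := Cross of bool | Cup of bool | Cap.

Definition slice : Type := (nat * tile)%type.
Definition diagram : Type := seq slice.
Definition boundary : Type := seq bool.

Definition tile_in (t : tile) : nat := if t is Cup _ then 0 else 2.
Definition tile_out (t : tile) : nat := if t is Cap then 0 else 2.

Definition fits (e : boundary) (s : slice) : bool :=
  let: (i, t) := s in
  match t with
  | Cross _ => (i.+1 < size e)%N
  | Cup _ => (i <= size e)%N
  | Cap => (i.+1 < size e)%N && (nth false e i != nth false e i.+1)
  end.

Definition upper (e : boundary) (s : slice) : boundary :=
  let: (i, t) := s in
  take i e ++
  match t with
  | Cross _ => [:: nth false e i.+1; nth false e i]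
  | Cup d => [:: d; ~~ d]
  | Cap => [::]
  end ++ drop (i + tile_in t) e.

Fixpoint well_formed (e : boundary) (D : diagram) (e' : boundary) : bool :=
  if D is s :: D' then fits e s && well_formed (upper e s) D' e' else e == e'.

(* The boundary on the horizontal line below the [k]-th slice. *)
Definition level (e : boundary) (D : diagram) (k : nat) : boundary :=
  foldl upper e (take k D).

Definition ups (n : nat) : boundary := nseq n true.

(** * Isotopy *)

(* Planar isotopies of sliced diagrams (exchange of distant slices,
   straightening, sliding a strand across a minimum or a maximum) and
   Reidemeister moves.  All orientations are covered, since those of the strands
   of a tile are determined by the boundary. *)
Inductive move : diagram -> diagram -> Prop :=
| move_exchange i s r t :
    move [:: (i, s); (i + tile_out s + r, t)%N]
         [:: (i + tile_in s + r, t)%N; (i, s)]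
| move_zigzagl i d : move [:: (i.+1, Cup d); (i, Cap)] [::]
| move_zigzagr i d : move [:: (i, Cup d); (i.+1, Cap)] [::]
| move_slide_cup i d k :
    move [:: (i, Cup d); (i.+1, Cross k)] [:: (i.+1, Cup d); (i, Cross (~~ k))]
| move_slide_cap i k :
    move [:: (i.+1, Cross k); (i, Cap)] [:: (i, Cross (~~ k)); (i.+1, Cap)]
| move_R1_cup i d k : move [:: (i, Cup d); (i, Cross k)] [:: (i, Cup (~~ d))]
| move_R1_cap i k : move [:: (i, Cross k); (i, Cap)] [:: (i, Cap)]
| move_R2 i k : move [:: (i, Cross k); (i, Cross (~~ k))] [::]
| move_R3 i k :
    move [:: (i, Cross k); (i.+1, Cross k); (i, Cross k)]
         [:: (i.+1, Cross k); (i, Cross k); (i.+1, Cross k)].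

Definition move_in_context (e e' : boundary) (D1 D2 : diagram) : Prop :=
  [/\ well_formed e D1 e', well_formed e D2 e' &
      exists A L L' B, [/\ move L L', D1 = A ++ L ++ B & D2 = A ++ L' ++ B]].

Definition isotopic (e e' : boundary) : diagram -> diagram -> Prop :=
  clos_refl_sym_trans diagram (move_in_context e e').

(** * Strands and string links *)

(* An end of a slice: [(false, p)] and [(true, p)] are the [p]-th points of its
   lower and of its upper boundary.  A point [(k, p)] of a diagram is the [p]-th
   point of the horizontal line below the [k]-th slice. *)
Definition slice_end : Type := (bool * nat)%type.
Definition point : Type := (nat * nat)%type.

Definition point_of (k : nat) (a : slice_end) : point := ((k + a.1)%N, a.2).

Definition end_boundary (e : boundary) (s : slice) (a : slice_end) : boundary :=
  if a.1 then upper e s else e.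

(* The other end of the arc of the slice [s] ending at [a]. *)
Definition across (s : slice) (a : slice_end) : slice_end :=
  let: (i, t) := s in
  let: (c, p) := a in
  match t with
  | Cross _ => (~~ c, if p == i then i.+1 else if p == i.+1 then i else p)
  | Cup _ =>
      if c then
        if p == i then (true, i.+1)
        else if p == i.+1 then (true, i)
        else (false, if (p < i)%N then p else (p - 2)%N)
      else (true, if (p < i)%N then p else (p + 2)%N)
  | Cap =>
      if c then (false, if (p < i)%N then p else (p + 2)%N)
      else
        if p == i then (false, i.+1)
        else if p == i.+1 then (false, i)
        else (true, if (p < i)%N then p else (p - 2)%N)
  end.

Definition slice_of (D : diagram) (k : nat) : slice := nth (0%N, Cap) D k.

Definition joined (e : boundary) (D : diagram) (x y : point) : Prop :=
  exists k a, let s := slice_of D k in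
  [/\ (k < size D)%N, (a.2 < size (end_boundary (level e D k) s a))%N,
      x = point_of k a & y = point_of k (across s a)].

Definition same_component (e : boundary) (D : diagram) : point -> point -> Prop :=
  clos_refl_sym_trans point (joined e D).

Definition is_point (e : boundary) (D : diagram) (x : point) : bool :=
  (x.1 <= size D)%N && (x.2 < size (level e D x.1))%N.

(* Every component contains exactly one bottom and exactly one top endpoint: the
   components are [n] intervals from bottom to top, and none is closed. *)
Definition string_link (n : nat) (D : diagram) : Prop :=
  well_formed (ups n) D (ups n) /\
  forall x, is_point (ups n) D x ->
    (exists! i : 'I_n, same_component (ups n) D (0%N, nat_of_ord i) x) /\
    (exists! j : 'I_n, same_component (ups n) D x (size D, nat_of_ord j)).

(** * Admissible paths and the random walk invariant *)

Definition over_ends (s : slice) : seq slice_end :=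
  match s with
  | (i, Cross true) => [:: (false, i); (true, i.+1)]
  | (i, Cross false) => [:: (false, i.+1); (true, i)]
  | _ => [::]
  end.

Definition under_ends (s : slice) : seq slice_end :=
  match s with
  | (i, Cross true) => [:: (false, i.+1); (true, i)]
  | (i, Cross false) => [:: (false, i); (true, i.+1)]
  | _ => [::]
  end.

Definition positive (e : boundary) (s : slice) : bool :=
  if s is (i, Cross k) then k == (nth false e i == nth false e i.+1) else false.

(* [incoming] ends are those where the orientation enters the slice. *)
Definition incoming (e : boundary) (s : slice) (a : slice_end) : bool :=
  (a.2 < size (end_boundary e s a))%N &&
  (nth false (end_boundary e s a) a.2 == ~~ a.1).

Definition outgoing (e : boundary) (s : slice) (a : slice_end) : bool :=
  (a.2 < size (end_boundary e s a))%N &&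
  (nth false (end_boundary e s a) a.2 == a.1).

Definition may_pass (e : boundary) (s : slice) (a b : slice_end) : bool :=
  [&& incoming e s a, outgoing e s b &
      (b == across s a) || (a \in over_ends s) && (b \in under_ends s)].

Definition passage_weight (F : fieldType) (t : F) (e : boundary) (s : slice)
    (a b : slice_end) : F :=
  let u := if positive e s then t else t^-1 in
  if a \in over_ends s then (if b == across s a then u else 1 - u) else 1.

(* [(k, a, b)]: the [k]-th slice is entered at [a] and left at [b]. *)
Definition passage : Type := (nat * slice_end * slice_end)%type.

Fixpoint admissible (e : boundary) (D : diagram) (x : point) (P : seq passage)
    (y : point) : bool :=
  if P is (k, a, b) :: P' then
    [&& (k < size D)%N, may_pass (level e D k) (slice_of D k) a b,
        x == point_of k a & admissible e D (point_of k b) P' y]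
  else x == y.

Definition path_weight (F : fieldType) (t : F) (e : boundary) (D : diagram)
    (P : seq passage) : F :=
  \prod_(q <- P)
    passage_weight t (level e D q.1.1) (slice_of D q.1.1) q.1.2 q.2.

Definition paths (n : nat) (D : diagram) (i j : 'I_n) : set (seq passage) :=
  [set P | admissible (ups n) D (0%N, nat_of_ord i) P (size D, nat_of_ord j)].

(* The family [f] is absolutely summable on [A], with sum [v]. *)
Definition has_sum (R : realType) (I : choiceType) (A : set I) (f : I -> R)
    (v : R) : Prop :=
  let g := fun x => (f x)%:E in
  summable A g /\ (\esum_(x in A) g^\+ x - \esum_(x in A) g^\- x = v%:E)%E.

Definition Qt : fieldType := {fraction {poly rat}}.
Definition qt : Qt := FracField.tofrac ('X : {poly rat}).

(* The rational function [f] is defined at [x], with value [v]. *)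
Definition has_value (R : realType) (f : Qt) (x v : R) : Prop :=
  exists p q : {poly rat},
    [/\ f = FracField.tofrac p / FracField.tofrac q,
        (map_poly ratr q).[x] != 0 &
        v = (map_poly ratr p).[x] / (map_poly ratr q).[x]].

(* [M] is the matrix of rational functions to which the path sums converge for
   [t] close to 1; it is unique, as a rational function is determined by its
   values near 1. *)
Definition is_random_walk_matrix (R : realType) (n : nat) (D : diagram)
    (M : 'M[Qt]_n) : Prop :=
  \forall t \near (1 : R), forall i j : 'I_n,
    exists2 v, has_value (M j i) t v &
      has_sum (paths D i j) (path_weight t (ups n) D) v.

(** * Braids *)

(* The letters [(i, true)] and [(i, false)] are the generator crossing the
   strands at positions [i] and [i.+1] (counted from 0) and its inverse. *)
Definition braid_word (N : nat) : Type := seq ('I_N.-1 * bool).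

Definition burau_generator (N : nat) (i : 'I_N.-1) : 'M[Qt]_N :=
  \matrix_(r < N, c < N)
    if (r == i :> nat) && (c == i :> nat) then 1 - qt
    else if (r == i :> nat) && (c == i.+1 :> nat) then 1
    else if (r == i.+1 :> nat) && (c == i :> nat) then qt
    else if (r == i.+1 :> nat) && (c == i.+1 :> nat) then 0
    else (r == c)%:R.

Definition burau_letter (N : nat) (x : 'I_N.-1 * bool) : 'M[Qt]_N :=
  if x.2 then burau_generator x.1 else invmx (burau_generator x.1).

Definition burau (N : nat) (b : braid_word N) : 'M[Qt]_N :=
  \big[mulmx/1%:M]_(x <- b) burau_letter x.

(* A product [x * y] is [x] on top of [y], whereas slices are listed from bottom
   to top. *)
Definition braid_diagram (N : nat) (b : braid_word N) : diagram :=
  [seq (nat_of_ord x.1, Cross x.2) | x <- rev b].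

(* The closing arcs are nested to the right of the braid, the strand at position
   [n] being closed by the outermost one. *)
Definition closure_diagram (n m : nat) (b : braid_word (n + m)) : diagram :=
  [seq ((n + k)%N, Cup true) | k <- iota 0 m] ++
  braid_diagram b ++
  [seq ((n + k)%N, Cap) | k <- rev (iota 0 m)].

(* Main.v *)
Require Import Defs.
From mathcomp Require Import all_boot all_order all_algebra.
From mathcomp Require Import fraction.
From mathcomp Require Import all_classical all_reals all_analysis.
From mathcomp Require Import zify ring lra.

Set Implicit Arguments.
Unset Strict Implicit.
Unset Printing Implicit Defensive.

Import Order.TTheory GRing.Theory Num.Theory.
Import numFieldNormedType.Exports.
Local Open Scope ring_scope.

(** The path sums solve a linear system.  Fix a bottom point and give every point
    of a diagram the total weight of the admissible paths that arrive at it.  In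
    each slice these values obey linear rules: the two legs of a minimum or of a
    maximum carry the same value, and at a crossing the overcrossing strand is
    multiplied by a power u of t, whereas the undercrossing strand gains 1 - u
    times the value arriving along the overcrossing one.  An assignment of values
    obeying these rules is a coloring of the diagram ([trace]).  Whatever the
    orientations, the two values above a crossing are determined by the two values
    below it ([crossed]).

    Isotopy.  The rules are local, so that each move, apart from the exchange of
    distant slices, reduces to linear identities between at most three strands,
    valid for all nonzero t.  Hence isotopic diagrams have the same pairs of bottom
    and top values extending to a coloring, and uniqueness of the coloring with
    given bottom values holds for both or for none ([isotopic_invariance]).

    String links.  Let W be the matrix of the weights of single passages between
    points.  A coloring, read as a row vector f, satisfies f = f W + (bottom
    values) ([flow_eq]).  At t = 1 the weight 1 - u of a switch vanishes, so that
    W follows the strands; as every component ends at a top point, W is nilpotent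
    there ([transfer1_nilpotent]).  Hence 1 - W, whose determinant is a rational
    function that does not vanish at 1, is invertible over Q(t)
    ([transfer_qt_unit]).  So colorings are determined by their bottom values
    ([unit_determined]), and the top values are entries of the inverse of 1 - W
    ([output_entry]).

    Convergence.  The paths of length L contribute an entry of the L-th power of W
    ([sum_walks]).  Nilpotency at 1 yields a positive vector that is halved by the
    matrix of absolute values of weights for t close to 1 ([near1_contraction]),
    so that the powers decay geometrically, and the path sums converge absolutely
    to the entries of the inverse of 1 - W ([walks_has_sum]).

    Closures.  A column w with B (v, w) = (v', w), for the Burau matrix B of the
    braid, extends to a coloring of the closure with bottom values v, top values v'
    and values w on the closing arcs ([closure_trace]).  A vector w fixed by Q would
    thus color the closure with zero bottom values, which by uniqueness,
    transported along the isotopy, forces w = 0: so 1 - Q is invertible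
    ([closure_unit]).  Then w = (1 - Q)^-1 Z v gives v' = (X + Y (1 - Q)^-1 Z) v, and
    the same v' is read at the top of the string link. *)

(** * Colorings of diagrams *)

Lemma nth_cat_addn (A : Type) (x0 : A) (l s : seq A) k :
  nth x0 (l ++ s) (size l + k) = nth x0 s k.
Proof. by rewrite nth_cat ltnNge leq_addr addKn. Qed.

Lemma drop_cat_addn (A : Type) (l s : seq A) k :
  drop (size l + k) (l ++ s) = drop k s.
Proof. by rewrite drop_cat ltnNge leq_addr addKn. Qed.

Section Colorings.
Variables (F : fieldType) (t : F).

(** The orientation of a strand is kept next to its value, since the rule at a
    crossing depends on both. *)
Definition coloring : Type := seq (bool * F).

(** When the undercrossing strand is oriented upwards, the overcrossing one is
    multiplied from bottom to top by t or by its inverse, according to the tile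
    alone: reversing the overcrossing strand inverts both the sign of the crossing
    and the direction in which it is passed.  Reversing the undercrossing strand
    inverts the factor, and it moves the gain of that strand to the other side of
    the equation.  The gain, 1 - u times the value arriving along the overcrossing
    strand, is here expressed by the lower value of that strand. *)
Definition crossed (k : bool) (x y : bool * F) : coloring :=
  let: (o, u) := if k then (x, y) else (y, x) in
  let c := if k == u.1 then t else t^-1 in
  let o' := (o.1, c * o.2) in
  let u' := (u.1, u.2 + (if o.1 == u.1 then 1 - c else c - 1) * o.2) in
  if k then [:: u'; o'] else [:: o'; u'].

Definition tile_colored (tl : tile) (a a' : coloring) : Prop :=
  match tl with
  | Cross k => exists x y, a = [:: x; y] /\ a' = crossed k x y
  | Cup d => exists z, a = [::] /\ a' = [:: (d, z); (~~ d, z)]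
  | Cap => exists d z, a = [:: (d, z); (~~ d, z)] /\ a' = [::]
  end.

Definition slice_colored (s : slice) (c c' : coloring) : Prop :=
  exists l a a' r,
    [/\ size l = s.1, tile_colored s.2 a a', c = l ++ a ++ r &
        c' = l ++ a' ++ r].

(** [T] lists the colorings of the horizontal lines above the successive slices;
    the bottom coloring [c] is kept apart. *)
Fixpoint trace (c : coloring) (D : diagram) (T : seq coloring) : Prop :=
  match D, T with
  | [::], [::] => True
  | s :: D', c' :: T' => slice_colored s c c' /\ trace c' D' T'
  | _, _ => False
  end.

Definition orientations (c : coloring) : boundary := map fst c.

Lemma crossed_size k x y : size (crossed k x y) = 2.
Proof. by case: k. Qed.

Lemma orientations_crossed k x y :
  orientations (crossed k x y) = [:: y.1; x.1].
Proof. by case: k. Qed.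

Lemma tile_colored_size tl a a' :
  tile_colored tl a a' -> size a = tile_in tl /\ size a' = tile_out tl.
Proof.
case: tl => [k|d|] /=.
- by move=> [x [y [-> ->]]]; rewrite crossed_size.
- by move=> [z [-> ->]].
- by move=> [d [z [-> ->]]].
Qed.

Lemma slice_colored_upper s c c' : slice_colored s c c' ->
  fits (orientations c) s /\ orientations c' = upper (orientations c) s.
Proof.
case: s => i tl [l [a [a' [r [/= <- tcol -> ->]]]]].
rewrite /upper /orientations !map_cat -(size_map fst l) take_size_cat//.
rewrite drop_cat_addn.
have [sa _] := tile_colored_size tcol.
rewrite drop_size_cat ?size_map// !size_cat !size_map sa.
have nth0 s := nth_cat_addn false (map fst l) s 0.
have nth1 s := nth_cat_addn false (map fst l) s 1.
rewrite size_map addn0 addn1 in nth0 nth1.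
case: tl tcol {sa} => [k|d|] /=.
- move=> [x [y [-> ->]]]; rewrite -!/(orientations _) orientations_crossed /=.
  by rewrite nth0 nth1 /=; split => //; lia.
- by move=> [z [_ ->]]; split => //; lia.
- move=> [d [z [-> ->]]] /=.
  by rewrite nth0 nth1 /=; split=> //; case: d; rewrite andbT; lia.
Qed.

(** Strands on the left are spectators.  Stripping them reduces every move to its
    instance at position 0. *)
Lemma slice_colored_cat l j tl c c' :
  slice_colored ((size l + j)%N, tl) (l ++ c) c' <->
  exists c0, c' = l ++ c0 /\ slice_colored (j, tl) c c0.
Proof.
split=> [[l0 [a [a' [r [/= sl tcol e ->]]]]]|
         [c0 [-> [l0 [a [a' [r [/= sl tcol -> ->]]]]]]]]; last first.
  exists (l ++ l0), a, a', r; split=> //; rewrite ?size_cat ?sl//.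
    by rewrite !catA.
  by rewrite !catA.
have e0 : l0 = l ++ take j c.
  have := congr1 (take (size l + j)) e.
  by rewrite (take_size_cat _ sl) take_cat ltnNge leq_addr /= addKn => ->.
have sj : size (take j c) = j.
  by apply: (@addnI (size l)); rewrite -size_cat -e0.
exists (take j c ++ a' ++ r); rewrite {1}e0 -!catA; split=> //.
exists (take j c), a, a', r; split=> //.
move: e; rewrite {1}e0 -!catA => /(congr1 (drop (size l))).
by rewrite !drop_size_cat.
Qed.

Lemma slice_colored_cons i tl x c c' :
  slice_colored (i.+1, tl) (x :: c) c' <->
  exists c0, c' = x :: c0 /\ slice_colored (i, tl) c c0.
Proof. exact: (slice_colored_cat [:: x] i). Qed.

Lemma slice_colored_cross k c c' :
  slice_colored (0%N, Cross k) c c' <->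
  exists x y r, c = [:: x, y & r] /\ c' = crossed k x y ++ r.
Proof.
split=> [[l [a [a' [r [/size0nil-> [x [y [-> ->]]] -> ->]]]]]|[x [y [r [-> ->]]]]].
  by exists x, y, r.
by exists [::], [:: x; y], (crossed k x y), r; split=> //; exists x, y.
Qed.

Lemma slice_colored_cup d c c' :
  slice_colored (0%N, Cup d) c c' <->
  exists z, c' = [:: (d, z), (~~ d, z) & c].
Proof.
split=> [[l [a [a' [r [/size0nil-> [z [-> ->]] -> ->]]]]]|[z ->]]; first by exists z.
by exists [::], [::], [:: (d, z); (~~ d, z)], c; split=> //; exists z.
Qed.

Lemma slice_colored_cap c c' :
  slice_colored (0%N, Cap) c c' <->
  exists d z, c = [:: (d, z), (~~ d, z) & c'].
Proof.
split=> [[l [a [a' [r [/size0nil-> [d [z [-> ->]]] -> ->]]]]]|[d [z ->]]].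
  by exists d, z.
by exists [::], [:: (d, z); (~~ d, z)], [::], c'; split=> //; exists d, z.
Qed.

Definition shifted (i : nat) (L : diagram) : diagram :=
  [seq ((i + s.1)%N, s.2) | s <- L].

Lemma trace_shift l L c T : trace (l ++ c) (shifted (size l) L) T <->
  exists T0, T = map (cat l) T0 /\ trace c L T0.
Proof.
elim: L c T => [|[j tl] L IH] c [|c' T] /=.
- by split=> // _; exists [::].
- by split=> // -[[|? ?]] [].
- by split=> // -[[|? ?]] [].
rewrite slice_colored_cat; split=> [[[c0 [-> sc]] /IH [T0 [-> tr]]]|].
  by exists (c0 :: T0).
move=> [[|c0 T0] []//= [-> ->] [sc tr]].
by split; [exists c0 | apply/IH; exists T0].
Qed.

Lemma trace_cat c D1 D2 T : trace c (D1 ++ D2) T <->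
  exists T1 T2, [/\ T = T1 ++ T2, trace c D1 T1 & trace (last c T1) D2 T2].
Proof.
elim: D1 c T => [|s D1 IH] c T /=.
  split=> [tr|[[|? ?] [T2 [-> //]]]].
  by exists [::], T.
case: T => [|c' T]; first by split=> // -[[|? ?] [? [? ? ?]]].
split=> [[sc /IH[T1 [T2 [-> tr1 tr2]]]]|].
  by exists (c' :: T1), T2.
move=> [[|c1 T1] [T2 []]] //= [-> ->] [sc tr1] tr2; split=> //.
by apply/IH; exists T1, T2.
Qed.

Lemma trace_size c D T : trace c D T -> size T = size D.
Proof. by elim: D c T => [|s D IH] c [|c' T] //= [_ /IH->]. Qed.

Lemma trace_level c D T k : trace c D T -> (k <= size D)%N ->
  orientations (nth [::] (c :: T) k) = level (orientations c) D k.
Proof.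
elim: D c T k => [|s D IH] c [|c' T] [|k] //= [sc tr] lekD.
by rewrite /level /= (IH c')// (slice_colored_upper sc).2.
Qed.

End Colorings.

(** * Local invariance under moves *)

Section Moves.
Variables (F : fieldType) (t : F).

Local Notation coloring := (coloring F).
Local Notation trace := (trace t).
Local Notation slice_colored := (slice_colored t).
Local Notation crossed := (crossed t).
Implicit Types (c : coloring) (L D : diagram) (T : seq coloring).

Definition transferred c L L' : Prop :=
  forall T, trace c L T -> exists2 T', trace c L' T' & last c T' = last c T.

(** The value on a new minimum is free, so that the bottom coloring does not
    determine a trace; on both sides of a move that value is visible at the top. *)
Definition tied c L : Prop :=
  forall T T', trace c L T -> trace c L T' -> last c T = last c T' -> T = T'.

Definition locally_equivalent c L L' : Prop :=
  [/\ transferred c L L', transferred c L' L, tied c L & tied c L'].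

Lemma last_map_cat (l c : coloring) T : last (l ++ c) (map (cat l) T) = l ++ last c T.
Proof. by rewrite last_map. Qed.

Lemma transferred_shift (l : coloring) c L L' : transferred c L L' ->
  transferred (l ++ c) (shifted (size l) L) (shifted (size l) L').
Proof.
move=> tra _ /trace_shift[T [-> /tra[T' tr' e]]].
exists (map (cat l) T'); first by apply/trace_shift; exists T'.
by rewrite !last_map_cat e.
Qed.

Lemma tied_shift (l : coloring) c L : tied c L ->
  tied (l ++ c) (shifted (size l) L).
Proof.
move=> td _ _ /trace_shift[T [-> tr]] /trace_shift[T' [-> tr']].
rewrite !last_map_cat => /(congr1 (drop (size l))); rewrite !drop_size_cat// => e.
by rewrite (td _ _ tr tr' e).
Qed.

Lemma locally_equivalent_shift i c L L' : (i <= size c)%N ->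
  locally_equivalent (drop i c) L L' ->
  locally_equivalent c (shifted i L) (shifted i L').
Proof.
move=> lic [tLL' tL'L tL tL'].
have <- : size (take i c) = i by rewrite size_take_min; apply/minn_idPl.
rewrite -{1}(cat_take_drop i c).
by split; (apply: transferred_shift || apply: tied_shift).
Qed.

Lemma trace_nilP c T : trace c [::] T -> T = [::].
Proof. by case: T. Qed.

Lemma trace_consP c s L T : trace c (s :: L) T ->
  exists c' T', [/\ T = c' :: T', slice_colored s c c' & trace c' L T'].
Proof. by case: T => [|c' T] //= [sc tr]; exists c', T. Qed.

Lemma slice_colored_split j k tl c c' : slice_colored ((j + k)%N, tl) c c' ->
  exists l c0 c0', [/\ size l = j, c = l ++ c0, c' = l ++ c0' &
                       slice_colored (k, tl) c0 c0'].
Proof.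
move=> sc; have ljc : (j <= size c)%N.
  by case: sc => [l [a [a' [r [/= sl _ -> _]]]]]; rewrite size_cat sl; lia.
have sj : size (take j c) = j by rewrite size_take_min; apply/minn_idPl.
have := sc; rewrite -[X in slice_colored _ X](cat_take_drop j c) -[X in (X + k)%N]sj.
move=> /slice_colored_cat[c0 [-> sc0]].
by exists (take j c), (drop j c), c0; rewrite cat_take_drop.
Qed.

Lemma slice_colored_bottom tl c c' : slice_colored (0%N, tl) c c' <->
  exists a a' r, [/\ tile_colored t tl a a', c = a ++ r & c' = a' ++ r].
Proof.
split=> [[l [a [a' [r [/size0nil-> ta -> ->]]]]]|[a [a' [r [ta -> ->]]]]].
  by exists a, a', r.
by exists [::], a, a', r.
Qed.

Lemma cat_inj (A : Type) (a a' b b' : seq A) :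
  size a = size a' -> a ++ b = a' ++ b' -> a = a' /\ b = b'.
Proof.
elim: a a' => [|x a IH] [|x' a'] //= [/IH{}IH] [-> /IH[-> ->]].
by [].
Qed.

(** Distant slices color disjoint parts of a horizontal line. *)
Lemma exchange_local c s r s' :
  locally_equivalent c [:: (0%N, s); (tile_out s + r, s')%N]
                       [:: (tile_in s + r, s')%N; (0%N, s)].
Proof.
split.
- move=> ? /trace_consP[? [? [-> /slice_colored_bottom[a [a' [c0 [ta -> ->]]]]]]].
  have [sa sa'] := tile_colored_size ta.
  move=> /trace_consP[? [? [-> + /trace_nilP->]]].
  rewrite -sa' => /slice_colored_cat[c0' [-> sc]].
  exists [:: a ++ c0'; a' ++ c0'] => //; split; last split => //.
    by rewrite -sa; apply/slice_colored_cat; exists c0'.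
  by apply/slice_colored_bottom; exists a, a', c0'.
- move=> ? /trace_consP[? [? [-> /slice_colored_split[l [c0 [c0' [sl -> -> sc]]]]]]].
  move=> /trace_consP[? [? [-> /slice_colored_bottom[a [a' [c1 [ta + ->]]]]]]].
  have [sa sa'] := tile_colored_size ta.
  move=> /cat_inj[]; rewrite ?sl ?sa// => -> <- /trace_nilP->.
  exists [:: a' ++ c0; a' ++ c0'] => //; split; last split => //.
    by apply/slice_colored_bottom; exists a, a', c0.
  by rewrite -sa'; apply/slice_colored_cat; exists c0'.
- move=> ? ? /trace_consP[? [? [-> /slice_colored_bottom[a [a' [c0 [ta -> ->]]]]]]].
  have [sa sa'] := tile_colored_size ta.
  move=> /trace_consP[? [? [-> + /trace_nilP->]]].
  rewrite -sa' => /slice_colored_cat[c0' [-> sc]].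
  move=> /trace_consP[? [? [-> /slice_colored_bottom[b [b' [d0 [tb + ->]]]]]]].
  have [sb sb'] := tile_colored_size tb.
  move=> /cat_inj[]; first by rewrite sa sb.
  move=> eab <- /trace_consP[? [? [-> + /trace_nilP->]]].
  rewrite sa' -sb' => /slice_colored_cat[d0' [-> _]] /= /cat_inj[].
    by rewrite sa' sb'.
  by move=> -> ->.
- move=> ? ? /trace_consP[? [? [-> /slice_colored_split[l [c0 [c0' [sl -> -> sc]]]]]]].
  move=> /trace_consP[? [? [-> /slice_colored_bottom[a [a' [c1 [ta + ->]]]]]]].
  have [sa sa'] := tile_colored_size ta.
  move=> /cat_inj[]; rewrite ?sl ?sa// => el <- /trace_nilP->.
  move=> /trace_consP[? [? [-> /slice_colored_split[m [d0 [d0' [sm + -> _]]]]]]].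
  move=> /cat_inj[]; first by rewrite sl sm.
  move=> -> _ /trace_consP[? [? [-> /slice_colored_bottom[b [b' [d1 [tb + ->]]]]]]].
  have [sb sb'] := tile_colored_size tb.
  move=> /cat_inj[]; rewrite ?sm ?sb// => _ <- /trace_nilP-> /=.
  by move=> /cat_inj[]; rewrite ?sa' ?sb'// => -> ->.
Qed.

Definition is_cup (s : slice) : bool := if s.2 is Cup _ then true else false.

Lemma slice_colored_fun s c c1 c2 : ~~ is_cup s ->
  slice_colored s c c1 -> slice_colored s c c2 -> c1 = c2.
Proof.
case: s => i tl /= ncup [l [a [a1 [r [/= sl tcol -> ->]]]]].
move=> [l' [b [b1 [r' [/= sl' tcol' /eqP e ->]]]]].
have [sa _] := tile_colored_size tcol; have [sb _] := tile_colored_size tcol'.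
move: e; rewrite eqseq_cat ?sl ?sl'// eqseq_cat ?sa ?sb//.
move=> /and3P[/eqP-> /eqP eab /eqP->]; congr (_ ++ _ ++ _).
case: tl ncup tcol tcol' {sa sb} => [k|d|] //= _.
  by move=> [x [y [ea ->]]] [x' [y' [eb ->]]]; move: eab; rewrite ea eb => -[-> ->].
by move=> [? [? [_ ->]]] [? [? [_ ->]]].
Qed.

Lemma tied_cupless c L : all (fun s => ~~ is_cup s) L -> tied c L.
Proof.
move=> ncup T T' + + _; elim: L c T T' ncup => [|s L IH] c [|c1 T] [|c2 T'] //=.
move=> /andP[ns nL] [sc tr] [sc' tr'].
have e := slice_colored_fun ns sc sc'; rewrite e in tr *.
by rewrite (IH _ _ _ nL tr tr').
Qed.

Hypothesis t_neq0 : t != 0.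

Lemma colored_cross k x y c :
  slice_colored (0%N, Cross k) [:: x, y & c] (crossed k x y ++ c).
Proof. by apply/slice_colored_cross; exists x, y, c. Qed.

(** Computes the colorings of concrete diagrams: the hypotheses are reduced to
    equations between values, one goal for each choice of orientations. *)
Ltac colored_inversion :=
  repeat match goal with
  | H : trace _ (_ :: _) _ |- _ =>
      apply trace_consP in H; destruct H as [? [? [? ? H]]]; subst
  | H : trace _ [::] _ |- _ =>
      apply trace_nilP in H; subst
  | H : _ /\ _ |- _ => destruct H
  | H : slice_colored (_.+1, _) (_ :: _) _ |- _ =>
      apply slice_colored_cons in H; destruct H as [? [? H]]; subst
  | H : slice_colored (_, Cross _) _ _ |- _ =>
      apply slice_colored_cross in H;
      let x := fresh "x" in let y := fresh "y" in
      let E := fresh "E" in let E' := fresh "E" in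
      destruct H as [x [y [? [E E']]]];
      destruct x as [[] ?], y as [[] ?]; simpl in E, E'; subst
  | H : slice_colored (_, Cup _) _ _ |- _ =>
      apply slice_colored_cup in H; destruct H as [? ?]; subst
  | H : slice_colored (_, Cap) _ _ |- _ =>
      apply slice_colored_cap in H; destruct H as [[] [? ?]]; subst
  | H : _ :: _ = _ :: _ |- _ =>
      simpl in H; first [discriminate H | injection H; clear H; intros; subst]
  end.

Ltac values :=
  repeat first [ reflexivity
    | match goal with
      | |- _ :: _ = _ :: _ => apply: (f_equal2 cons)
      | |- (_, _) = (_, _) => apply: (f_equal2 pair)
      end ];
  try (by field).

(** The second strand passes back under, respectively over, the first one, with
    the inverse factor. *)
Lemma crossedK k x y :
  exists x' y', crossed k x y = [:: x'; y'] /\ crossed (~~ k) x' y' = [:: x; y].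
Proof.
case: k x y => [] [[] v] [[] w]; rewrite /crossed /=; do 2 eexists;
  split=> //=; values.
Qed.

Lemma R2_local k c : (1 < size c)%N ->
  locally_equivalent c [:: (0%N, Cross k); (0%N, Cross (~~ k))] [::].
Proof.
case: c => [|x [|y c]]// _; split.
- move=> T tr; exists [::] => //; destruct k; colored_inversion => /=; values.
- move=> [|//] _; have [x' [y' [e e']]] := crossedK k x y.
  exists [:: [:: x', y' & c]; [:: x, y & c]] => //=.
  have := colored_cross k x y c; have := colored_cross (~~ k) x' y' c.
  by rewrite e e'.
- exact: tied_cupless.
- by move=> [|//] [|//].
Qed.

Ltac colored := simpl; lazymatch goal with
  | |- slice_colored (S _, _) _ _ =>
      apply/slice_colored_cons; eexists; split; [reflexivity | colored]
  | |- slice_colored (_, Cross _) _ _ =>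
      apply/slice_colored_cross; do 3 eexists; split; [reflexivity | simpl; values]
  | |- slice_colored (_, Cup _) _ _ =>
      apply/slice_colored_cup; eexists; simpl; values
  | |- slice_colored (_, Cap) _ _ =>
      apply/slice_colored_cap; do 2 eexists; simpl; values
  end.

Ltac colored_trace :=
  lazymatch goal with
  | |- _ = _ => simpl; values
  | |- _ => repeat (split; [colored|]); try exact I
  end.

Lemma solve_linear (k a b a' b' : F) : a' = b' -> a - b = k * (a' - b') -> a = b.
Proof. by move=> ->; rewrite subrr mulr0 => /subr0_eq. Qed.

(** The goal is a multiple of the equation [H] between values; the factor is a unit
    of the ring of Laurent polynomials in t. *)
Ltac linear H :=
  first [ apply: (solve_linear (k := 1) H); by field
        | apply: (solve_linear (k := -1) H); by field
        | apply: (solve_linear (k := t) H); by field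
        | apply: (solve_linear (k := - t) H); by field
        | apply: (solve_linear (k := t^-1) H); by field
        | apply: (solve_linear (k := - t^-1) H); by field ].

Ltac values_from_hypothesis :=
  match goal with H : ?a = ?b :> GRing.Field.sort _ |- _ => linear H end.

(** In a kink the strand crosses itself, and the value it loses when passing over
    is given back when it passes under: x = u x + (1 - u) x. *)
Lemma R1_cup_local d k c :
  locally_equivalent c [:: (0%N, Cup d); (0%N, Cross k)] [:: (0%N, Cup (~~ d))].
Proof.
split.
- move=> T tr; destruct d, k; colored_inversion;
  (eexists [:: _]; [|reflexivity]); colored_trace.
- move=> ? /trace_consP[_ [T [-> /slice_colored_cup[z ->] /trace_nilP->]]].
  (* The loop carries another value than the two free ends: the overcrossing
     strand is multiplied between them. *)
  exists [:: [:: (d, if d then t * z else t^-1 * z),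
                 (~~ d, if d then t * z else t^-1 * z) & c];
             [:: (~~ d, z), (d, z) & c]]; last by rewrite /= negbK.
  by destruct d, k => /=; colored_trace.
- move=> T T' tr tr' E; destruct d, k; colored_inversion; simpl in E;
  colored_inversion; values; values_from_hypothesis.
- by move=> T T' tr tr' E; colored_inversion; simpl in E; colored_inversion;
  values.
Qed.

Lemma R1_cap_local k c :
  locally_equivalent c [:: (0%N, Cross k); (0%N, Cap)] [:: (0%N, Cap)].
Proof.
split.
- move=> T tr; destruct k; colored_inversion;
  (eexists [:: _]; [|reflexivity]); colored_trace; values_from_hypothesis.
- by move=> T tr; destruct k; colored_inversion; eexists [:: _; _]; colored_trace.
- exact: tied_cupless.
- exact: tied_cupless.
Qed.

(** Both composites of crossings are linear maps on three strands; they are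
    compared for the eight orientations. *)
Lemma R3_local k c : locally_equivalent c
    [:: (0%N, Cross k); (1%N, Cross k); (0%N, Cross k)]
    [:: (1%N, Cross k); (0%N, Cross k); (1%N, Cross k)].
Proof.
split.
- by move=> T tr; destruct k; colored_inversion; eexists [:: _; _; _]; colored_trace.
- move=> T tr; destruct c as [|[[] ?] c].
    by case: T tr => [|? ?] // [[[|? ?] [? [? [? []]]]]].
  1,2: by destruct k; colored_inversion; eexists [:: _; _; _]; colored_trace.
- exact: tied_cupless.
- exact: tied_cupless.
Qed.

Lemma zigzagl_local c d : (0 < size c)%N -> (nth false (orientations c) 0 != d) ->
  locally_equivalent c [:: (1%N, Cup d); (0%N, Cap)] [::].
Proof.
case: c => [|[b v] c]//= _ bd.
have {bd}-> : b = ~~ d by move: bd; case: b; case: d.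
split.
- by move=> T tr; exists [::] => //; destruct d; colored_inversion; colored_trace.
- move=> [|//] _; exists [:: [:: (~~ d, v), (d, v), (~~ d, v) & c]; (~~ d, v) :: c] => //.
  by destruct d; colored_trace.
- by move=> T T' tr tr' E; destruct d; colored_inversion; values.
- by move=> [|//] [|//].
Qed.

Lemma zigzagr_local c d : (0 < size c)%N -> (nth false (orientations c) 0 == d) ->
  locally_equivalent c [:: (0%N, Cup d); (1%N, Cap)] [::].
Proof.
case: c => [|[b v] c]//= _ /eqP->.
split.
- by move=> T tr; exists [::] => //; destruct d; colored_inversion; colored_trace.
- move=> [|//] _; exists [:: [:: (d, v), (~~ d, v), (d, v) & c]; (d, v) :: c] => //.
  by destruct d; colored_trace.
- by move=> T T' tr tr' E; destruct d; colored_inversion; simpl in E;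
  colored_inversion; values.
- by move=> [|//] [|//].
Qed.

Lemma slide_cup_local c d k : (0 < size c)%N ->
  locally_equivalent c [:: (0%N, Cup d); (1%N, Cross k)]
                       [:: (1%N, Cup d); (0%N, Cross (~~ k))].
Proof.
case: c => [|x c]//= _; split.
- move=> ? /trace_consP[? [? [-> /slice_colored_cup[z ->]]]].
  move=> /trace_consP[c2 [? [-> sc /trace_nilP->]]].
  (* On the right the minimum ends as the third strand, on the left as the
     first: this gives its value. *)
  pose z' := (nth (d, 0) c2 2).2.
  exists [:: [:: x, (d, z'), (~~ d, z') & c]; c2] => //.
  by rewrite {}/z'; destruct x as [[] v], d, k; colored_inversion; colored_trace.
- move=> ? /trace_consP[? [? [-> /slice_colored_cons[? [-> /slice_colored_cup[z ->]]]]]].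
  move=> /trace_consP[c2 [? [-> sc /trace_nilP->]]].
  pose z' := (nth (d, 0) c2 0).2.
  exists [:: [:: (d, z'), (~~ d, z'), x & c]; c2] => //.
  by rewrite {}/z'; destruct x as [[] v], d, k; colored_inversion; colored_trace.
- by move=> T T' tr tr' E; destruct x as [[] v], d, k; colored_inversion;
  simpl in E; colored_inversion; values.
- by move=> T T' tr tr' E; destruct x as [[] v], d, k; colored_inversion;
  simpl in E; colored_inversion; values.
Qed.

Lemma slide_cap_local c k :
  locally_equivalent c [:: (1%N, Cross k); (0%N, Cap)]
                       [:: (0%N, Cross (~~ k)); (1%N, Cap)].
Proof.
split.
- move=> T tr; destruct c as [|[[] ?] c].
    by case: T tr => [|? ?] // [[[|? ?] [? [? [? []]]]]].
  1,2: by destruct k; colored_inversion; eexists [:: _; _]; colored_trace.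
- by move=> T tr; destruct k; colored_inversion; eexists [:: _; _]; colored_trace.
- exact: tied_cupless.
- exact: tied_cupless.
Qed.

End Moves.

(** * Isotopy invariance *)

Section Invariance.
Variables (F : fieldType) (t : F) (t_neq0 : t != 0).

Local Notation coloring := (coloring F).
Local Notation trace := (trace t).

Lemma locally_equivalent_at (c : coloring) i L L' M M' :
  shifted i L = M -> shifted i L' = M' -> (i <= size c)%N ->
  locally_equivalent t (drop i c) L L' -> locally_equivalent t c M M'.
Proof. by move=> <- <-; apply: locally_equivalent_shift. Qed.

Lemma move_local (c : coloring) L L' e e' : move L L' ->
  well_formed (orientations c) L e -> well_formed (orientations c) L' e' ->
  locally_equivalent t c L L'.
Proof.
have ori_drop i j :
    nth false (orientations (drop i c)) j = nth false (orientations c) (i + j).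
  by rewrite /orientations map_drop nth_drop.
have sz_ori : size (orientations c) = size c by rewrite size_map.
case=> [i s r s'|i d|i d|i d k|i k|i d k|i k|i k|i k] /= /andP[f wf] wf'.
- apply: (locally_equivalent_at (i := i) _ _ _ (exchange_local t _ s r s'));
    rewrite /shifted /= ?addn0 ?addnA//.
  by case: s f {wf wf'} => [k|d|] /=; rewrite ?sz_ori; lia.
- rewrite size_map in f.
  apply: (locally_equivalent_at (i := i) _ _ _ (zigzagl_local t _ _));
    rewrite /shifted /= ?addn0 ?addn1 ?size_drop //; try lia.
  move: wf; rewrite ori_drop addn0 => /andP[/andP[_]].
  have si : size (take i.+1 (orientations c)) = i.+1.
    by rewrite size_takel ?sz_ori.
  by rewrite !nth_cat si ltnS leqnn ltnn subnn /= nth_take// addn0 => ->.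
- rewrite size_map in f.
  have si : size (take i (orientations c)) = i by rewrite size_takel ?sz_ori.
  have nthi s j : nth false (take i (orientations c) ++ s) (i + j) = nth false s j.
    by rewrite -{2}si nth_cat_addn.
  move: wf => /andP[/andP[]]; rewrite size_cat si /= size_drop sz_ori.
  have := nthi [:: d, ~~ d & drop (i + 0) (orientations c)] 1%N.
  have := nthi [:: d, ~~ d & drop (i + 0) (orientations c)] 2%N.
  rewrite addn1 addn2 addn0 => -> -> /=; rewrite nth_drop addn0 => szi ori _.
  apply: (locally_equivalent_at (i := i) _ _ _ (zigzagr_local t _ _));
    rewrite /shifted /= ?addn0 ?addn1 ?size_drop //; try lia.
  by rewrite ori_drop addn0; move: ori; case: d; case: nth.
- move: wf' => /andP[f' _]; rewrite size_map in f'.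
  apply: (locally_equivalent_at (i := i) _ _ _ (slide_cup_local t_neq0 d k _));
    rewrite /shifted /= ?addn0 ?addn1 ?size_drop //; lia.
- move: wf' => /andP[f' _]; rewrite size_map in f'.
  apply: (locally_equivalent_at (i := i) _ _ _ (slide_cap_local t_neq0 _ k));
    rewrite /shifted /= ?addn0 ?addn1 //; lia.
- rewrite size_map in f.
  apply: (locally_equivalent_at (i := i) _ _ _ (R1_cup_local t_neq0 d k _));
    rewrite /shifted /= ?addn0 //; lia.
- rewrite size_map in f.
  apply: (locally_equivalent_at (i := i) _ _ _ (R1_cap_local t_neq0 k _));
    rewrite /shifted /= ?addn0 //; lia.
- rewrite size_map in f.
  apply: (locally_equivalent_at (i := i) _ _ _ (R2_local t_neq0 k _));
    rewrite /shifted /= ?addn0 ?size_drop //; lia.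
- rewrite size_map in f.
  apply: (locally_equivalent_at (i := i) _ _ _ (R3_local t_neq0 k _));
    rewrite /shifted /= ?addn0 ?addn1 //; lia.
Qed.

Definition reach (D : diagram) (c c' : coloring) : Prop :=
  exists2 T, trace c D T & last c T = c'.

(** For a diagram with a closed component this may fail: on a circle without
    crossings the value is arbitrary. *)
Definition determined (e : boundary) (D : diagram) : Prop :=
  forall c T T', orientations c = e -> trace c D T -> trace c D T' -> T = T'.

Lemma well_formed_cat e A B e' : well_formed e (A ++ B) e' =
  well_formed e A (foldl upper e A) && well_formed (foldl upper e A) B e'.
Proof.
elim: A e => [|s A IH] e /=; first by rewrite eqxx.
by rewrite IH andbA.
Qed.

Lemma trace_last c D T : trace c D T ->
  orientations (last c T) = foldl upper (orientations c) D.
Proof.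
elim: D c T => [|s D IH] c [|c' T] //= [sc /IH->].
by rewrite (slice_colored_upper sc).2.
Qed.

(** Two traces of the new diagram are carried to the old one, where they agree;
    hence they agree outside the replaced part, in which they are tied by their
    common ends. *)
Lemma determined_replace e A B L L' :
  (forall c, orientations c = foldl upper e A -> locally_equivalent t c L L') ->
  determined e (A ++ L ++ B) -> determined e (A ++ L' ++ B).
Proof.
move=> loc det c T T' ec.
move=> /trace_cat[TA [S [-> trA]]] /trace_cat[TL [TB [-> trL trB]]].
move=> /trace_cat[TA' [S' [-> trA']]] /trace_cat[TL' [TB' [-> trL' trB']]].
have /loc [_ tra _ _] : orientations (last c TA) = foldl upper e A.
  by rewrite (trace_last trA) ec.
have /loc [_ tra' _ tied'] : orientations (last c TA') = foldl upper e A.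
  by rewrite (trace_last trA') ec.
have [M trM eM] := tra _ trL; have [M' trM' eM'] := tra' _ trL'.
have trD : trace c (A ++ L ++ B) (TA ++ M ++ TB).
  apply/trace_cat; exists TA, (M ++ TB); split=> //.
  by apply/trace_cat; exists M, TB; rewrite eM.
have trD' : trace c (A ++ L ++ B) (TA' ++ M' ++ TB').
  apply/trace_cat; exists TA', (M' ++ TB'); split=> //.
  by apply/trace_cat; exists M', TB'; rewrite eM'.
have /cat_inj[] := det _ _ _ ec trD trD'.
  by rewrite (trace_size trA) (trace_size trA').
move=> eA /cat_inj[]; first by rewrite (trace_size trM) (trace_size trM').
move=> eqM ->; rewrite -eA in trL' eM' tied' *.
by rewrite (tied' _ _ trL trL')// -eM -eM' eqM.
Qed.

Lemma reach_replace c A B L L' c' :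
  (forall c0, orientations c0 = foldl upper (orientations c) A ->
     transferred t c0 L L') ->
  reach (A ++ L ++ B) c c' -> reach (A ++ L' ++ B) c c'.
Proof.
move=> loc [_ /trace_cat[TA [_ [-> trA /trace_cat[TL [TB [-> trL trB]]]]]] <-].
have [M trM eM] := loc _ (trace_last trA) _ trL.
exists (TA ++ M ++ TB); last by rewrite !last_cat eM.
apply/trace_cat; exists TA, (M ++ TB); split=> //.
by apply/trace_cat; exists M, TB; rewrite eM.
Qed.

Lemma isotopic_invariance e e' D D' : isotopic e e' D D' ->
  (forall c c', orientations c = e -> reach D c c' <-> reach D' c c') /\
  (determined e D <-> determined e D').
Proof.
elim=> {D D'} [D D' [wf wf' [A [L [L' [B [mv eD eD']]]]]]||D D' _|D D' D'' _ + _] //.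
- move: wf wf'; rewrite {}eD {}eD' !well_formed_cat.
  move=> /andP[_ /andP[wfL _]] /andP[_ /andP[wfL' _]].
  have loc c : orientations c = foldl upper e A -> locally_equivalent t c L L'.
    by move=> ec; apply: move_local mv _ _; rewrite ec; [exact: wfL|exact: wfL'].
  split=> [c c' ec|]; split.
  + by apply: reach_replace => c0; rewrite ec => /loc[].
  + by apply: reach_replace => c0; rewrite ec => /loc[].
  + exact: determined_replace.
  + by apply: determined_replace => c /loc[].
- by move=> [r d]; split=> [c c' ec|]; [rewrite r | rewrite d].
- move=> [r d] [r' d']; split=> [c c' ec|]; first by rewrite r// r'.
  by rewrite d d'.
Qed.

End Invariance.

(** * Colorings of braid closures *)

Section Closures.
Variables (F : fieldType) (t : F).

Local Notation coloring := (coloring F).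

Definition upward (s : seq F) : coloring := [seq (true, x) | x <- s].
Definition downward (s : seq F) : coloring := [seq (false, x) | x <- s].
Definition entries (N : nat) (u : 'cV[F]_N) : seq F := [seq u i 0 | i <- enum 'I_N].

Lemma size_entries N (u : 'cV[F]_N) : size (entries u) = N.
Proof. by rewrite size_map size_enum_ord. Qed.

Lemma nth_entries N (u : 'cV[F]_N) x0 (i : 'I_N) : nth x0 (entries u) i = u i 0.
Proof. by rewrite (nth_map i) ?size_enum_ord// nth_ord_enum. Qed.

Lemma entries_inj N : injective (@entries N).
Proof.
move=> u v e; apply/matrixP => i j; rewrite ord1.
by rewrite -(nth_entries u 0) e nth_entries.
Qed.

Lemma entries_col_mx n m (v : 'cV[F]_n) (w : 'cV[F]_m) :
  entries (col_mx v w) = entries v ++ entries w.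
Proof.
apply: (@eq_from_nth _ 0) => [|i]; first by rewrite size_cat !size_entries.
rewrite size_entries => lt_i; rewrite (nth_entries _ _ (Ordinal lt_i)).
rewrite nth_cat size_entries; case: (ltnP i n) => [lt_in|le_ni].
  rewrite (nth_entries _ _ (Ordinal lt_in)) -(col_mxEu v w).
  by congr (col_mx v w _ _); apply: val_inj.
have lt_im : (i - n < m)%N by rewrite ltn_subLR.
rewrite (nth_entries _ _ (Ordinal lt_im)) -(col_mxEd v w).
by congr (col_mx v w _ _); apply: val_inj => /=; rewrite subnKC.
Qed.

Lemma orientations_upward s : orientations (upward s) = ups (size s).
Proof. by elim: s => //= x s ->. Qed.

Lemma reach_cat D1 D2 c c1 c2 :
  reach t D1 c c1 -> reach t D2 c1 c2 -> reach t (D1 ++ D2) c c2.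
Proof.
move=> [T1 tr1 e1] [T2 tr2 e2]; exists (T1 ++ T2); last by rewrite last_cat e1.
by apply/trace_cat; exists T1, T2; rewrite e1.
Qed.

Lemma reach_slice s c c' : slice_colored t s c c' -> reach t [:: s] c c'.
Proof. by move=> sc; exists [:: c']. Qed.

(** The values [ws] can be chosen freely on nested minima. *)
Lemma cups_reach (c r : coloring) ws :
  reach t [seq ((size c + k)%N, Cup true) | k <- iota 0 (size ws)]
    (c ++ r) (c ++ upward ws ++ downward (rev ws) ++ r).
Proof.
elim: ws c r => [|w ws IH] c r; first by exists [::].
rewrite /= -cat1s addn0.
apply: (@reach_cat _ _ _ (rcons c (true, w) ++ [:: (false, w) & r])).
  apply: reach_slice; exists c, [::], [:: (true, w); (false, w)], r.
  by split=> //; [exists w | rewrite cat_rcons].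
have := IH (rcons c (true, w)) [:: (false, w) & r].
rewrite size_rcons cat_rcons /= rev_cons /downward map_rcons !cat_rcons.
congr (reach _ _ _ _).
by rewrite -[1%N]addn0 iotaDl -map_comp; apply: eq_map => k /=; rewrite add1n addnS addSn.
Qed.

Lemma caps_reach (c r : coloring) ws :
  reach t [seq ((size c + k)%N, Cap) | k <- rev (iota 0 (size ws))]
    (c ++ upward ws ++ downward (rev ws) ++ r) (c ++ r).
Proof.
elim: ws c r => [|w ws IH] c r; first by exists [::].
rewrite /= rev_cons map_rcons -cats1 addn0.
apply: (@reach_cat _ _ _ (rcons c (true, w) ++ [:: (false, w) & r])).
  have := IH (rcons c (true, w)) [:: (false, w) & r].
  rewrite size_rcons cat_rcons /= rev_cons /downward map_rcons !cat_rcons.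
  congr (reach _ _ _ _); rewrite -[1%N]addn0 iotaDl -map_rev -map_comp.
  by apply: eq_map => k /=; rewrite add1n addnS addSn.
apply: reach_slice; exists c, [:: (true, w); (false, w)], [::], r.
by split=> //; [exists true, w | rewrite cat_rcons].
Qed.

Lemma slice_colored_upward i k s s' r : (i.+1 < size s)%N -> size s' = size s ->
  crossed t k (true, s`_i) (true, s`_i.+1) = [:: (true, s'`_i); (true, s'`_i.+1)] ->
  (forall j, j != i -> j != i.+1 -> s'`_j = s`_j) ->
  slice_colored t (i, Cross k) (upward s ++ r) (upward s' ++ r).
Proof.
move=> lt_is ss' ecr same.
have split_at (q : seq F) : size q = size s ->
    q = take i q ++ [:: q`_i, q`_i.+1 & drop i.+2 q].
  move=> sq; rewrite -[LHS](cat_take_drop i) (drop_nth 0) ?sq; last by lia.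
  by rewrite (drop_nth 0) ?sq.
have et : take i s' = take i s.
  apply: (@eq_from_nth _ 0) => [|j]; first by rewrite !size_take_min ss'.
  rewrite size_take_min leq_min => /andP[ltji _].
  by rewrite !nth_take// same//; lia.
have ed : drop i.+2 s' = drop i.+2 s.
  apply: (@eq_from_nth _ 0) => [|j]; first by rewrite !size_drop ss'.
  by move=> _; rewrite !nth_drop same//; lia.
exists (upward (take i s)), [:: (true, s`_i); (true, s`_i.+1)],
  (crossed t k (true, s`_i) (true, s`_i.+1)), (upward (drop i.+2 s) ++ r).
split; first by rewrite size_map size_takel ?(ltnW (ltnW lt_is)).
- by exists (true, s`_i), (true, s`_i.+1).
- by rewrite {1}(split_at s)// /upward map_cat -catA.
- by rewrite {1}(split_at s')// et ed ecr /upward map_cat -catA.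
Qed.

(** The identity matrix, except for a block of size 2 on the coordinates [i] and
    [i.+1]; it serves both for a Burau generator and for its inverse. *)
Definition block2_mx (N : nat) (i : 'I_N.-1) (a b c d : F) : 'M[F]_N :=
  \matrix_(r < N, s < N)
    if r == i :> nat then (if s == i :> nat then a
                           else if s == i.+1 :> nat then b else 0)
    else if r == i.+1 :> nat then (if s == i :> nat then c
                           else if s == i.+1 :> nat then d else 0)
    else (r == s)%:R.

Lemma ord_lower_subproof N (i : 'I_N.-1) : (i < N)%N.
Proof. by case: i => i /=; lia. Qed.
Lemma ord_upper_subproof N (i : 'I_N.-1) : (i.+1 < N)%N.
Proof. by case: i => i /=; lia. Qed.
Definition ord_lower N (i : 'I_N.-1) : 'I_N := Ordinal (ord_lower_subproof i).
Definition ord_upper N (i : 'I_N.-1) : 'I_N := Ordinal (ord_upper_subproof i).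

Lemma mul_block2_mx N p (i : 'I_N.-1) a b c d (u : 'M[F]_(N, p)) r s :
  (block2_mx i a b c d *m u) r s =
    if r == i :> nat then a * u (ord_lower i) s + b * u (ord_upper i) s
    else if r == i.+1 :> nat then c * u (ord_lower i) s + d * u (ord_upper i) s
    else u r s.
Proof.
rewrite mxE; under eq_bigr do rewrite mxE.
have luN : ord_upper i != ord_lower i by rewrite -val_eqE /=; lia.
case: ifP => [_|ri].
  rewrite (bigD1 (ord_lower i))//= eqxx (bigD1 (ord_upper i))//=.
  rewrite gtn_eqF// eqxx big1 ?addr0// => j /andP[].
  by rewrite -!val_eqE /= => /negPf-> /negPf->; rewrite mul0r.
case: ifP => [_|ri1].
  rewrite (bigD1 (ord_lower i))//= eqxx (bigD1 (ord_upper i))//=.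
  rewrite gtn_eqF// eqxx big1 ?addr0// => j /andP[].
  by rewrite -!val_eqE /= => /negPf-> /negPf->; rewrite mul0r.
rewrite (bigD1 r)//= eqxx mul1r big1 ?addr0// => j /negPf jr.
by rewrite eq_sym jr mul0r.
Qed.

Definition crossing_mx (N : nat) (x : 'I_N.-1 * bool) : 'M[F]_N :=
  if x.2 then block2_mx x.1 (1 - t) 1 t 0
  else block2_mx x.1 0 t^-1 1 (1 - t^-1).

Lemma crossing_mxV N (i : 'I_N.-1) : t != 0 ->
  invmx (crossing_mx (i, true)) = crossing_mx (i, false).
Proof.
move=> t_neq0; rewrite /crossing_mx /=.
set A := block2_mx i _ _ _ _; set B := block2_mx i _ _ _ _.
have AB : A *m B = 1%:M.
  apply/matrixP => r s.
  have low : (ord_lower i == i :> nat) by [].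
  have up0 : (ord_upper i == i :> nat) = false by apply: gtn_eqF.
  have up1 : (ord_upper i == i.+1 :> nat) by [].
  rewrite mul_block2_mx !mxE low up0 up1 -val_eqE /=.
  have [->|ri] := eqVneq (nat_of_ord r) i.
    rewrite [in RHS]eq_sym; case: eqVneq => [_|_].
      by rewrite mulr0 mul1r add0r.
    case: eqVneq => [_|_]; last by rewrite !mulr0 addr0.
    by rewrite mulr0n; field.
  have [->|//] := eqVneq (nat_of_ord r) i.+1.
  rewrite [in RHS]eq_sym; have [->|_] := eqVneq (nat_of_ord s) i.
    by rewrite ltn_eqF// mulr0 mul0r addr0.
  case: eqVneq => [_|_]; last by rewrite !mulr0 addr0.
  by rewrite mul0r addr0 mulfV.
have [Au _] := mulmx1_unit AB.
by rewrite -[RHS](mulKmx Au) AB mulmx1.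
Qed.

(** On upward strands the rule at a crossing is the Burau matrix of the letter. *)
Lemma crossing_reach N (x : 'I_N.-1 * bool) (u : 'cV[F]_N) r :
  reach t [:: (nat_of_ord x.1, Cross x.2)] (upward (entries u) ++ r)
    (upward (entries (crossing_mx x *m u)) ++ r).
Proof.
case: x => i k; apply: reach_slice; apply: slice_colored_upward;
  rewrite ?size_entries//.
- exact: ord_upper_subproof.
- have low (v : 'cV[F]_N) : (entries v)`_i = v (ord_lower i) 0.
    exact: (nth_entries v 0 (ord_lower i)).
  have upp (v : 'cV[F]_N) : (entries v)`_i.+1 = v (ord_upper i) 0.
    exact: (nth_entries v 0 (ord_upper i)).
  rewrite !low !upp /crossing_mx.
  case: k => /=; rewrite !mul_block2_mx /= ?eqxx gtn_eqF// ?eqxx.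
    by congr [:: (_, _); (_, _)]; rewrite /=; ring.
  by rewrite /crossed /=; congr [:: (_, _); (_, _)]; ring.
- move=> j /= ji ji1; case: (ltnP j N) => [lt_jN|le_Nj]; last first.
    by rewrite !nth_default ?size_entries.
  rewrite !(nth_entries _ _ (Ordinal lt_jN)) /crossing_mx.
  by case: k => /=; rewrite mul_block2_mx /= (negPf ji) (negPf ji1).
Qed.

End Closures.

Lemma qt_neq0 : qt != 0.
Proof. by rewrite /qt tofrac_eq0 polyX_eq0. Qed.

Lemma burau_generatorE N (i : 'I_N.-1) :
  burau_generator i = block2_mx i (1 - qt) 1 qt 0.
Proof.
apply/matrixP => r s; rewrite !mxE -val_eqE.
have [ri|ri] /= := eqVneq (nat_of_ord r) i.
  have [si|si] := eqVneq (nat_of_ord s) i; first by [].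
  have [si1|si1] := eqVneq (nat_of_ord s) i.+1; first by [].
  by rewrite ri ltn_eqF//= eq_sym (negPf si).
have [ri1|ri1] /= := eqVneq (nat_of_ord r) i.+1; last by [].
have [si|si] := eqVneq (nat_of_ord s) i; first by [].
have [si1|si1] := eqVneq (nat_of_ord s) i.+1; first by [].
by rewrite ri1 eq_sym (negPf si1).
Qed.

Lemma burau_letterE N (x : 'I_N.-1 * bool) : burau_letter x = crossing_mx qt x.
Proof.
case: x => i [] /=; rewrite /burau_letter /=.
  exact: burau_generatorE.
by rewrite burau_generatorE -(crossing_mxV _ qt_neq0).
Qed.

Lemma braid_reach N (b : braid_word N) (u : 'cV[Qt]_N) r :
  reach qt (braid_diagram b) (upward (entries u) ++ r)
    (upward (entries (burau b *m u)) ++ r).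
Proof.
elim: b => [|x b IH].
  by rewrite /burau big_nil mul1mx; exists [::].
rewrite /braid_diagram rev_cons map_rcons -cats1; apply: (reach_cat IH).
rewrite /burau big_cons -mulmxA burau_letterE.
exact: crossing_reach.
Qed.

(** The closing arcs carry the values [w] from the top of the braid back to its
    bottom.  These values are read off the line above the minima. *)
Lemma closure_trace n m (b : braid_word (n + m)) (v v' : 'cV[Qt]_n) (w : 'cV[Qt]_m) :
  burau b *m col_mx v w = col_mx v' w ->
  exists T, [/\ trace qt (upward (entries v)) (closure_diagram b) T,
    nth [::] (upward (entries v) :: T) m =
      upward (entries v ++ entries w) ++ downward (rev (entries w)) &
    last (upward (entries v)) T = upward (entries v')].
Proof.
move=> eb.
have su (x : 'cV[Qt]_n) : size (upward (entries x)) = n.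
  by rewrite size_map size_entries.
have [T1 tr1 e1] := cups_reach qt (upward (entries v)) [::] (entries w).
rewrite su size_entries !cats0 catA -[upward _ ++ upward _]map_cat in tr1 e1.
have [T2 tr2 e2] := braid_reach b (col_mx v w) (downward (rev (entries w))).
have [T3 tr3 e3] := caps_reach qt (upward (entries v')) [::] (entries w).
rewrite su size_entries !cats0 catA -[upward _ ++ upward _]map_cat in tr3 e3.
rewrite eb !entries_col_mx in tr2 e2.
exists (T1 ++ T2 ++ T3); split.
- apply/trace_cat; exists T1, (T2 ++ T3); split=> //.
  by apply/trace_cat; exists T2, T3; rewrite e1 e2.
- rewrite -[RHS]e1; have <- : size T1 = m.
    by rewrite (trace_size tr1) size_map size_iota.
  by rewrite -cat_cons nth_cat /= ltnSn nth_last.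
- by rewrite !last_cat e1 e2 e3.
Qed.

(** A vector fixed by [Q] and the zero vector color the closing arcs of two traces
    with the same bottom values. *)
Lemma closure_unit n m (b : braid_word (n + m)) :
  determined qt (ups n) (closure_diagram b) ->
  1%:M - drsubmx (burau b) \in unitmx.
Proof.
move=> det; rewrite -unitmx_tr -row_free_unit; apply: inj_row_free => x.
move=> /(congr1 trmx); rewrite trmx_mul trmxK trmx0 mulmxBl mul1mx.
move=> /subr0_eq; rewrite -[x](trmxK); move: (x^T) => w; rewrite trmxK => Qw.
have [] := @closure_trace n m b 0 (ursubmx (burau b) *m w) w.
  by rewrite -{1}(submxK (burau b)) mul_block_col !mulmx0 !add0r -Qw.
move=> T [tr ew _].
have [] := @closure_trace n m b 0 0 0; first by rewrite col_mx0 mulmx0.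
move=> T' [tr' ew' _].
have eT := det _ _ _ _ tr tr'.
move: ew; rewrite eT ?ew' => [|]; last first.
  by rewrite orientations_upward size_entries.
move=> /cat_inj[]; first by rewrite !size_map !size_cat !size_entries.
rewrite /upward !map_cat => /cat_inj[]// _ /inj_map e _.
suff -> : w = 0 by rewrite trmx0.
by apply/esym/entries_inj/e => y z [].
Qed.

Lemma closure_reach n m (b : braid_word (n + m)) (v : 'cV[Qt]_n) :
  let X := ulsubmx (burau b) in
  let Y := ursubmx (burau b) in
  let Z := dlsubmx (burau b) in
  let Q := drsubmx (burau b) in
  1%:M - Q \in unitmx ->
  reach qt (closure_diagram b) (upward (entries v))
    (upward (entries ((X + Y *m invmx (1%:M - Q) *m Z) *m v))).
Proof.
move=> X Y Z Q uQ; pose w := invmx (1%:M - Q) *m Z *m v.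
have [|T [tr _ eT]] := @closure_trace n m b v ((X + Y *m invmx (1%:M - Q) *m Z) *m v) w.
  rewrite -{1}(submxK (burau b)) mul_block_col mulmxDl -!mulmxA.
  congr col_mx; first by rewrite !mulmxA.
  apply/eqP; rewrite -subr_eq0 -addrA -opprB.
  rewrite -{1}[w]mul1mx -mulmxBl /w -mulmxA mulKVmx// subrr//.
by exists T.
Qed.

(** * Walks in a finite weighted graph *)

Section Walks.
Variables (E : eqType) (N : nat) (edges : seq E) (src tgt : E -> 'I_N).

Definition edge_mx (F : nzRingType) (wt : E -> F) : 'M[F]_N :=
  \matrix_(i, j) \sum_(q <- edges | (src q == i) && (tgt q == j)) wt q.

Lemma mul_edge_mx (F : nzRingType) (wt : E -> F) p (A : 'M[F]_(N, p)) i j :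
  (edge_mx wt *m A) i j = \sum_(q <- edges | src q == i) wt q * A (tgt q) j.
Proof.
rewrite mxE [RHS](partition_big tgt xpredT)//=; apply: eq_bigr => k _.
by rewrite mxE mulr_suml; apply: eq_bigr => q /andP[_ /eqP<-].
Qed.

Lemma mul_mx_edge (F : nzRingType) (wt : E -> F) p (A : 'M[F]_(p, N)) i j :
  (A *m edge_mx wt) i j = \sum_(q <- edges | tgt q == j) A i (src q) * wt q.
Proof.
rewrite mxE [RHS](partition_big src xpredT)//=; apply: eq_bigr => k _.
rewrite mxE mulr_sumr; apply: eq_big => [q|q /andP[/eqP<-]] //.
by rewrite andbC.
Qed.

Fixpoint is_walk (i : 'I_N) (P : seq E) (j : 'I_N) : bool :=
  if P is q :: P' then [&& q \in edges, src q == i & is_walk (tgt q) P' j]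
  else i == j.

Fixpoint walks (L : nat) (i j : 'I_N) : seq (seq E) :=
  if L is L'.+1 then
    [seq q :: P | q <- [seq q <- edges | src q == i], P <- walks L' (tgt q) j]
  else if i == j then [:: [::]] else [::].

Lemma mem_walks L i j P : (P \in walks L i j) = (size P == L) && is_walk i P j.
Proof.
elim: L i P => [|L IH] i [|q P] /=.
- by case: eqP; rewrite ?inE.
- by case: eqP.
- by apply/negP => /allpairsPdep[? [? []]].
apply/allpairsPdep/idP => [[q' [P' []]]|].
  rewrite mem_filter IH => /andP[src_q q_e] /andP[/eqP sP wP] [-> ->].
  by rewrite sP eqxx q_e src_q.
rewrite eqSS => /andP[sP /and3P[q_e src_q wP]]; exists q, P.
by rewrite mem_filter src_q q_e IH sP wP.
Qed.

Lemma uniq_walks L i j : uniq edges -> uniq (walks L i j).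
Proof.
move=> ue; elim: L i => [|L IH] i /=; first by case: eqP.
apply: allpairs_uniq_dep => [|q _|]; first exact: filter_uniq.
  exact: IH.
by move=> [q P] [q' P'] _ _ /= [-> ->].
Qed.

Lemma sum_walks (F : nzRingType) (wt : E -> F) L i j :
  \sum_(P <- walks L i j) \prod_(q <- P) wt q = (edge_mx wt ^+ L) i j.
Proof.
elim: L i => [|L IH] i.
  rewrite /= expr0 mxE; case: eqP => _; last by rewrite big_nil.
  by rewrite big_seq1 big_nil.
rewrite exprS (mul_edge_mx wt (edge_mx wt ^+ L)) big_allpairs_dep big_filter /=.
apply: eq_bigr => q _; rewrite -IH mulr_sumr.
by apply: eq_bigr => P _; rewrite big_cons.
Qed.

End Walks.

Lemma nilpotent_unit (F : fieldType) N (A : 'M[F]_N) r : A ^+ r = 0 ->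
  1%:M - A \in unitmx.
Proof.
move=> Ar; have : (1%:M - A) *m (\sum_(i < r) A ^+ i) = 1%:M.
  have := subrX1 A r; rewrite Ar sub0r => /(congr1 -%R).
  by rewrite opprK -mulNr opprB => /esym.
by case/mulmx1_unit.
Qed.

Lemma expmx_rows0 (F : fieldType) N (A : 'M[F]_N) :
  (forall i, exists r, forall j, (A ^+ r) i j = 0) -> exists r, A ^+ r = 0.
Proof.
move=> /choice[r Ar]; exists (\sum_i r i)%N; apply/matrixP => i j.
rewrite (bigD1 i)//= exprD -mulmxE mxE [RHS]mxE big1// => k _.
by rewrite Ar mul0r.
Qed.

(** * Points and passages of a diagram *)

Section Passages.
Variables (e : boundary) (D : diagram).

Definition valid_end (e : boundary) (s : slice) (a : slice_end) : bool :=
  (a.2 < size (end_boundary e s a))%N.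

Definition ends (e : boundary) (s : slice) : seq slice_end :=
  [seq (false, p) | p <- iota 0 (size e)] ++
  [seq (true, p) | p <- iota 0 (size (upper e s))].

Lemma mem_ends e' s a : (a \in ends e' s) = valid_end e' s a.
Proof.
case: a => [c p]; rewrite mem_cat /valid_end /end_boundary /=.
apply/orP/idP => [[] /mapP[p']|].
- by rewrite mem_iota /= => p_lt [-> ->].
- by rewrite mem_iota /= => p_lt [-> ->].
by case: c => p_lt; [right|left]; apply/mapP; exists p; rewrite ?mem_iota.
Qed.

Lemma uniq_ends e' s : uniq (ends e' s).
Proof.
rewrite cat_uniq !map_inj_uniq ?iota_uniq//=; [|by move=> ? ? []..].
by rewrite andbT; apply/hasPn => a /mapP[p _ ->]; apply/negP => /mapP[].
Qed.

Definition passages : seq passage :=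
  [seq (k, ab.1, ab.2) | k <- iota 0 (size D),
     ab <- [seq (a, b) | a <- ends (level e D k) (slice_of D k),
                         b <- [seq b <- ends (level e D k) (slice_of D k) |
                               may_pass (level e D k) (slice_of D k) a b]]].

Lemma mem_passages k a b : ((k, a, b) \in passages) =
  (k < size D)%N && may_pass (level e D k) (slice_of D k) a b.
Proof.
apply/allpairsPdep/andP => [[k' [_ [+ /allpairsPdep[a' [b' [_ + ->]]] [-> -> ->]]]]|].
  by rewrite mem_iota mem_filter /= => -> /andP[].
move=> [lt_k pass]; exists k, (a, b); split=> //; first by rewrite mem_iota.
have /and3P[/andP[va _] /andP[vb _] _] := pass.
by apply/allpairsPdep; exists a, b; rewrite mem_filter pass !mem_ends.
Qed.

Lemma uniq_passages : uniq passages.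
Proof.
apply: allpairs_uniq_dep => [|k _|]; first exact: iota_uniq.
  apply: allpairs_uniq_dep => [|a _|]; first exact: uniq_ends.
    exact/filter_uniq/uniq_ends.
  by move=> [a b] [a' b'] _ _ /= [-> ->].
by move=> [k [a b]] [k' [a' b']] _ _ /= [-> -> ->].
Qed.

Definition source (q : passage) : Defs.point := point_of q.1.1 q.1.2.
Definition target (q : passage) : Defs.point := point_of q.1.1 q.2.

Definition points : seq Defs.point :=
  [seq (k, p) | k <- iota 0 (size D).+1, p <- iota 0 (size (level e D k))].

Lemma mem_points x : (x \in points) = is_point e D x.
Proof.
case: x => k p; apply/allpairsPdep/andP => [[k' [p' []]]|[lek ltp]].
  by rewrite !mem_iota !add0n ltnS => /andP[_ lek] /andP[_ ltp] [-> ->].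
by exists k, p; split; rewrite // mem_iota.
Qed.

Lemma uniq_points : uniq points.
Proof.
apply: allpairs_uniq_dep => [|k _|]; [exact: iota_uniq..|].
by move=> [k p] [k' p'] _ _ /= [-> ->].
Qed.

(** The last index, [size points], is a dummy vertex without edges, so that the
    index type is inhabited even if the diagram has no point. *)
Definition rank (x : Defs.point) : 'I_(size points).+1 := inord (index x points).

Lemma rank_inj x y : is_point e D x -> rank x = rank y -> x = y.
Proof.
rewrite -mem_points => xP /(congr1 val); rewrite /rank /=.
rewrite !inordK ?ltnS ?index_size// => exy.
by rewrite -(nth_index (0%N, 0%N) xP) exy nth_index// -index_mem -exy index_mem.
Qed.

Definition point_at (i : 'I_(size points).+1) : Defs.point :=
  nth ((size D).+1, 0%N) points i.

Lemma point_at_rank z : is_point e D z -> point_at (rank z) = z.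
Proof.
rewrite -mem_points => zP; rewrite /point_at /rank inordK ?nth_index//.
by rewrite ltnS index_size.
Qed.

Lemma rank_point_at (i : 'I_(size points).+1) : (i < size points)%N ->
  is_point e D (point_at i) /\ rank (point_at i) = i.
Proof.
move=> lt_i; rewrite -mem_points mem_nth//; split=> //.
apply: val_inj; rewrite /= inordK; last by rewrite ltnS index_size.
by rewrite index_uniq// uniq_points.
Qed.

Lemma levelS k : (k < size D)%N ->
  level e D k.+1 = upper (level e D k) (slice_of D k).
Proof.
by move=> lt_k; rewrite /level (take_nth (0%N, Cap) lt_k) foldl_rcons.
Qed.

Lemma end_boundary_level k a : (k < size D)%N ->
  end_boundary (level e D k) (slice_of D k) a = level e D (k + a.1).
Proof.
by move=> lt_k; case: a => [[] p]; rewrite /end_boundary /= ?addn0 ?addn1 ?levelS.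
Qed.

Lemma valid_end_point k a : (k < size D)%N ->
  valid_end (level e D k) (slice_of D k) a -> is_point e D (point_of k a).
Proof.
move=> lt_k; rewrite /valid_end end_boundary_level// /is_point /= => ->.
by case: a.1; lia.
Qed.

Lemma passage_points q : q \in passages ->
  is_point e D (source q) /\ is_point e D (target q).
Proof.
case: q => [[k a] b]; rewrite mem_passages => /andP[lt_k].
by move=> /and3P[/andP[va _] /andP[vb _] _]; split; apply: valid_end_point.
Qed.

Lemma admissible_walk x P y : is_point e D x -> is_point e D y ->
  admissible e D x P y =
  is_walk passages (rank \o source) (rank \o target) (rank x) P (rank y).
Proof.
move=> + yp; elim: P x => [|[[k a] b] P IH] x xp /=.
  by apply/eqP/eqP => [->|/(rank_inj xp)].
rewrite mem_passages -andbA; case: (boolP (_ < _)%N) => //= lt_k.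
case: (boolP (may_pass _ _ _ _)) => //= pass.
have [sp tp] : is_point e D (point_of k a) /\ is_point e D (point_of k b).
  by apply: (passage_points (q := (k, a, b))); rewrite mem_passages lt_k.
rewrite IH//; congr (_ && _).
by apply/eqP/eqP => [->|/(rank_inj sp)].
Qed.

Lemma well_formed_fits e' k : well_formed e D e' -> (k < size D)%N ->
  fits (level e D k) (slice_of D k).
Proof.
rewrite -[in well_formed _ _](cat_take_drop k D) => + lt_k.
rewrite (drop_nth (0%N, Cap) lt_k) well_formed_cat => /andP[_ /=].
by case/andP.
Qed.

Lemma well_formed_top e' : well_formed e D e' -> level e D (size D) = e'.
Proof.
rewrite /level take_size; elim: D e => [|s D' IH] e1 /=; first by move/eqP.
by move=> /andP[_ /IH].
Qed.

End Passages.

(** * Colorings as flows *)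

Lemma acrossK s : involutive (across s).
Proof.
case: s => i [k|d|] [c p] /=.
  rewrite negbK; congr (_, _); case: (eqVneq p i) => [->|pi].
    by rewrite gtn_eqF// eqxx.
  case: (eqVneq p i.+1) => [->|pi1]; first by rewrite eqxx.
  by rewrite (negPf pi) (negPf pi1).
all: case: c => /=.
- case: eqP => [->|pi]; first by rewrite eqxx gtn_eqF.
  case: eqP => [->|pi1]; first by rewrite eqxx.
  case: (ltnP p i) => [lt_pi|le_ip]; first by rewrite lt_pi.
  by case: ltnP => ?; [exfalso; lia | congr (_, _); lia].
- case: (ltnP p i) => [lt_pi|le_ip] /=.
    by rewrite (ltn_eqF lt_pi) (ltn_eqF (leqW lt_pi)) lt_pi.
  have lt_ip : (i.+1 < p + 2)%N by lia.
  by rewrite (gtn_eqF (ltnW lt_ip)) (gtn_eqF lt_ip) ltnNge (ltnW (ltnW lt_ip)) addnK.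
- case: (ltnP p i) => [lt_pi|le_ip] /=.
    by rewrite (ltn_eqF lt_pi) (ltn_eqF (leqW lt_pi)) lt_pi.
  have lt_ip : (i.+1 < p + 2)%N by lia.
  by rewrite (gtn_eqF (ltnW lt_ip)) (gtn_eqF lt_ip) ltnNge (ltnW (ltnW lt_ip)) addnK.
- case: eqP => [->|pi]; first by rewrite eqxx gtn_eqF.
  case: eqP => [->|pi1]; first by rewrite eqxx.
  case: (ltnP p i) => [lt_pi|le_ip]; first by rewrite lt_pi.
  by case: ltnP => ?; [exfalso; lia | congr (_, _); lia].
Qed.

Section LocalFlow.
Variables (F : fieldType) (t : F).
Local Notation coloring := (coloring F).

Definition end_color (c c' : coloring) (a : slice_end) : bool * F :=
  nth (false, 0) (if a.1 then c' else c) a.2.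

(** An arc that goes through the slice has the same orientation at both ends; one
    that turns back has opposite orientations. *)
Lemma across_end s c c' a : slice_colored t s c c' ->
  (a.2 < size (if a.1 then c' else c))%N ->
  [/\ ((across s a).2 < size (if (across s a).1 then c' else c))%N,
      a \notin over_ends s ++ under_ends s ->
        (end_color c c' (across s a)).2 = (end_color c c' a).2 &
      (end_color c c' (across s a)).1 =
        (a.1 == (across s a).1) (+) (end_color c c' a).1].
Proof.
rewrite /end_color.
case: s => i tl [l [m [m' [r [/= <- + -> ->]]]]]; case: a => q p.
have nth_l (w : coloring) j : (j < size l)%N ->
    nth (false, 0) (l ++ w ++ r) j = nth (false, 0) l j.
  by rewrite nth_cat => ->.
have nth_m (w : coloring) j : (j < size w)%N ->
    nth (false, 0) (l ++ w ++ r) (size l + j) = nth (false, 0) w j.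
  by rewrite nth_cat_addn nth_cat => ->.
have nth_m0 (w : coloring) : (0 < size w)%N ->
    nth (false, 0) (l ++ w ++ r) (size l) = nth (false, 0) w 0%N.
  by rewrite -[in nth _ _ (size l)](addn0 (size l)); apply: nth_m.
have nth_m1 (w : coloring) : (1 < size w)%N ->
    nth (false, 0) (l ++ w ++ r) (size l).+1 = nth (false, 0) w 1%N.
  by rewrite -[(size l).+1]addn1; apply: nth_m.
have nth_r (w : coloring) j : (size l + size w <= j)%N ->
    nth (false, 0) (l ++ w ++ r) j = nth (false, 0) r (j - (size l + size w)).
  move=> le_j; rewrite !nth_cat subnDA.
  have -> : (j < size l)%N = false by lia.
  by have -> : (j - size l < size w)%N = false by lia.
case: tl => [k|d|] /=.
- move=> [x [y [-> em']]]; have sm' : size m' = 2 by rewrite em' crossed_size.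
  have ori_m' : (nth (false, 0) m' 0%N).1 = y.1 /\ (nth (false, 0) m' 1%N).1 = x.1.
    by rewrite em'; case: k {em'}.
  have -> : (q == ~~ q) = false by case: q.
  have mem_tile q' : (q', size l) \in over_ends (size l, Cross k) ++
      under_ends (size l, Cross k) /\ (q', (size l).+1) \in
      over_ends (size l, Cross k) ++ under_ends (size l, Cross k).
    by case: k q' {em'} => [] []; rewrite /= !inE !xpair_eqE !eqxx /= ?orbT.
  have [t0 t1] := mem_tile q.
  have szc q' j : (j < size (if q' then l ++ m' ++ r else l ++ [:: x; y] ++ r))%N
      = (j < size l + 2 + size r)%N.
    by case: q'; rewrite !size_cat ?sm' addnA.
  rewrite !szc.
  have nth0 q' : nth (false, 0) (if q' then l ++ m' ++ r else l ++ [:: x; y] ++ r)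
      (size l) = if q' then nth (false, 0) m' 0%N else x.
    by rewrite -[size l]addn0; case: q'; rewrite nth_m// sm'.
  have nth1 q' : nth (false, 0) (if q' then l ++ m' ++ r else l ++ [:: x; y] ++ r)
      (size l).+1 = if q' then nth (false, 0) m' 1%N else y.
    by rewrite -[(size l).+1]addn1; case: q'; rewrite nth_m// sm'.
  case: (eqVneq p (size l)) => [->|pi] szp.
    rewrite t0 nth0 nth1; split=> //; first lia.
    by case: (q); rewrite /= ?ori_m'.2 ?ori_m'.1.
  case: (eqVneq p (size l).+1) szp => [->|pi1] szp.
    rewrite t1 nth0 nth1; split=> //; first lia.
    by case: (q); rewrite /= ?ori_m'.2 ?ori_m'.1.
  suff -> : nth (false, 0) (if ~~ q then l ++ m' ++ r else l ++ [:: x; y] ++ r) p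
      = nth (false, 0) (if q then l ++ m' ++ r else l ++ [:: x; y] ++ r) p by [].
  case: (ltnP p (size l)) => [lt_p|le_p].
    by case: (q); rewrite !nth_l.
  by case: (q) => /=; rewrite (nth_r m') ?sm' ?(nth_r [:: x; y])//=; lia.
- move=> [z [-> ->]]; case: q => /= szp.
    case: eqP szp => [->|pi] szp.
      rewrite (nth_m0 [:: (d, z); (~~ d, z)])//.
      rewrite (nth_m1 [:: (d, z); (~~ d, z)])//=; split=> //.
        by move: szp; rewrite !size_cat /=; lia.
    case: eqP szp => [->|pi1] szp.
      rewrite (nth_m0 [:: (d, z); (~~ d, z)])//.
      rewrite (nth_m1 [:: (d, z); (~~ d, z)])//=; split=> //.
        by move: szp; rewrite !size_cat /=; lia.
      by rewrite negbK.
    case: (ltnP p (size l)) szp => [lt_p|le_p] szp /=.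
      rewrite (nth_l [::])// (nth_l [:: (d, z); (~~ d, z)])//; split=> //.
      by move: szp; rewrite !size_cat /=; lia.
    rewrite (nth_r [::])/=; last lia.
    rewrite (nth_r [:: (d, z); (~~ d, z)])/=; last lia.
    have -> : (p - 2 - (size l + 0) = p - (size l + 2))%N by lia.
    by split=> //; move: szp; rewrite !size_cat /=; lia.
  case: (ltnP p (size l)) szp => [lt_p|le_p] szp /=.
    rewrite (nth_l [::])// (nth_l [:: (d, z); (~~ d, z)])//; split=> //.
    by move: szp; rewrite !size_cat /=; lia.
  rewrite (nth_r [::])/=; last lia.
  rewrite (nth_r [:: (d, z); (~~ d, z)])/=; last lia.
  have -> : (p + 2 - (size l + 2) = p - (size l + 0))%N by lia.
  by split=> //; move: szp; rewrite !size_cat /=; lia.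
- move=> [d [z [-> ->]]]; case: q => /= szp.
    case: (ltnP p (size l)) szp => [lt_p|le_p] szp /=.
      rewrite (nth_l [::])// (nth_l [:: (d, z); (~~ d, z)])//; split=> //.
      by move: szp; rewrite !size_cat /=; lia.
    rewrite (nth_r [::])/=; last lia.
    rewrite (nth_r [:: (d, z); (~~ d, z)])/=; last lia.
    have -> : (p + 2 - (size l + 2) = p - (size l + 0))%N by lia.
    by split=> //; move: szp; rewrite !size_cat /=; lia.
  case: eqP szp => [->|pi] szp.
    rewrite (nth_m0 [:: (d, z); (~~ d, z)])//.
      rewrite (nth_m1 [:: (d, z); (~~ d, z)])//=; split=> //.
      by move: szp; rewrite !size_cat /=; lia.
  case: eqP szp => [->|pi1] szp.
    rewrite (nth_m0 [:: (d, z); (~~ d, z)])//.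
      rewrite (nth_m1 [:: (d, z); (~~ d, z)])//=; split=> //.
      by move: szp; rewrite !size_cat /=; lia.
    by rewrite negbK.
  case: (ltnP p (size l)) szp => [lt_p|le_p] szp /=.
    rewrite (nth_l [::])// (nth_l [:: (d, z); (~~ d, z)])//; split=> //.
    by move: szp; rewrite !size_cat /=; lia.
  rewrite (nth_r [::])/=; last lia.
  rewrite (nth_r [:: (d, z); (~~ d, z)])/=; last lia.
  have -> : (p - 2 - (size l + 0) = p - (size l + 2))%N by lia.
  by split=> //; move: szp; rewrite !size_cat /=; lia.
Qed.

End LocalFlow.

Lemma across_over s a : (across s a \in over_ends s) = (a \in over_ends s).
Proof.
have impl b : b \in over_ends s -> across s b \in over_ends s.
  case: s => i [[]|d|] //; rewrite !inE => /orP[] /eqP->; rewrite /across;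
    by rewrite !(eqxx, gtn_eqF (ltnSn i)) ?eqxx ?orbT.
by apply/idP/idP => [/impl|/impl//]; rewrite acrossK.
Qed.

Lemma over_under s a : a \in over_ends s -> a \notin under_ends s.
Proof.
case: s => i [[]|d|] //; rewrite !inE => /orP[] /eqP->;
  by rewrite !xpair_eqE /= ?orbF ?(ltn_eqF (ltnSn i)) ?(gtn_eqF (ltnSn i)).
Qed.

Lemma nth_orientations (F : fieldType) (c : coloring F) p :
  nth false (orientations c) p = (nth (false, 0) c p).1.
Proof. by elim: c p => [|x c IH] [|p] //=. Qed.

(** The zero coloring; it makes facts on colorings available for boundaries. *)
Lemma fits_colored (F : fieldType) (t : F) e s : fits e s ->
  exists c c', orientations c = e /\ slice_colored t s c c'.
Proof.
case: s => i tl f; pose c : coloring F := [seq (b, 0) | b <- e].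
have oc : orientations c = e.
  by rewrite /orientations -map_comp -[RHS]map_id; apply: eq_map.
have sc : size c = size e by rewrite size_map.
have split2 : (i.+1 < size c)%N ->
    c = take i c ++ [:: nth (false, 0) c i; nth (false, 0) c i.+1] ++ drop i.+2 c.
  move=> lt_i; rewrite -[LHS](cat_take_drop i) (drop_nth (false, 0)); last exact: ltnW.
  by rewrite (drop_nth (false, 0)).
case: tl f => [k|d|] f.
- have lt_i : (i.+1 < size c)%N by rewrite sc.
  exists c, (take i c ++ crossed t k (nth (false, 0) c i) (nth (false, 0) c i.+1)
             ++ drop i.+2 c); split=> //.
  eexists _, _, _, _; split; last reflexivity; [|by do 2 eexists|exact: split2].
  by rewrite size_takel//= ltnW// ltnW.
- exists c, (take i c ++ [:: (d, 0); (~~ d, 0)] ++ drop i c); split=> //.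
  eexists _, [::], _, _; split; last reflexivity; [|by exists 0|].
    by rewrite size_takel// sc.
  by rewrite cat_take_drop.
- case/andP: f => lt_ie ne; have lt_i : (i.+1 < size c)%N by rewrite sc.
  exists c, (take i c ++ drop i.+2 c); split=> //.
  exists (take i c), [:: nth (false, 0) c i; nth (false, 0) c i.+1], [::], (drop i.+2 c).
  split=> //; first by rewrite size_takel//= ltnW// ltnW.
    exists (nth false e i), 0; split=> //.
    rewrite !(nth_map false)//; last exact: ltnW.
    by congr [:: _; (_, _)]; move: ne; case: nth; case: nth.
  exact: split2.
Qed.

Section Orientation.
Variables (e : boundary) (s : slice).
Hypothesis fit : fits e s.

Lemma across_valid a : valid_end e s a -> valid_end e s (across s a) /\
  nth false (end_boundary e s (across s a)) (across s a).2 =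
  (a.1 == (across s a).1) (+) nth false (end_boundary e s a) a.2.
Proof.
have [c [c' [<- sc]]] := fits_colored (1 : rat) fit.
have [_ oc'] := slice_colored_upper sc.
have eb b : end_boundary (orientations c) s b = orientations (if b.1 then c' else c).
  by rewrite /end_boundary -oc'; case: ifP.
rewrite /valid_end !eb !size_map => va; have [v _ o] := across_end sc va.
by split=> //; rewrite !nth_orientations.
Qed.

Lemma outgoing_across a : outgoing e s (across s a) = incoming e s a.
Proof.
have val_across b : valid_end e s (across s b) = valid_end e s b.
  by apply/idP/idP => /across_valid[]//; rewrite acrossK.
rewrite /outgoing /incoming -!/(valid_end _ _ _) val_across.
case: (boolP (valid_end e s a)) => //= /across_valid[_ ->].
by case: a.1; case: (across s a).1; case: nth.
Qed.

Lemma incoming_across a : incoming e s (across s a) = outgoing e s a.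
Proof. by rewrite -outgoing_across acrossK. Qed.

(** The ends by which a path may enter the slice so as to leave it at [b]: the other
    end of the same arc and, if [b] lies on the undercrossing strand, the end by
    which the overcrossing one enters. *)
Definition entries_of (b : slice_end) : seq slice_end :=
  across s b ::
  if b \in under_ends s then [seq a <- over_ends s | incoming e s a] else [::].

Lemma may_passE a b : outgoing e s b -> may_pass e s a b = (a \in entries_of b).
Proof.
move=> out_b; rewrite /may_pass out_b inE.
have -> : (b == across s a) = (a == across s b).
  by apply/eqP/eqP => ->; rewrite acrossK.
case: eqP => [->|_] /=; first by rewrite incoming_across out_b.
case: (b \in under_ends s); last by rewrite andbF andbF.
by rewrite andbT mem_filter.
Qed.

Lemma uniq_entries_of b : uniq (entries_of b).
Proof.
rewrite /entries_of; case: ifP => //= ub; rewrite filter_uniq ?andbT.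
  rewrite mem_filter across_over; apply/negP => /andP[_ /over_under].
  by rewrite ub.
by case: s => i [[]|d|] //=; rewrite inE.
Qed.

End Orientation.

(** Here the bottom-to-top rule of [crossed] is turned into the rule along the
    orientation, in which each value is what arrives through one passage. *)
Lemma flow_local (F : fieldType) (t : F) s (c c' : coloring F) b : t != 0 ->
  slice_colored t s c c' -> outgoing (orientations c) s b ->
  \sum_(a <- entries_of (orientations c) s b)
     passage_weight t (orientations c) s a b * (end_color c c' a).2 =
  (end_color c c' b).2.
Proof.
move=> t_neq0 sc out_b; have [fit oc'] := slice_colored_upper sc.
have vb : (b.2 < size (if b.1 then c' else c))%N.
  case/andP: out_b => + _; rewrite /end_boundary -oc'.
  by case: ifP => _; rewrite size_map.
have [_ same_val _] := across_end sc vb.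
case: (boolP (b \in over_ends s ++ under_ends s)) => [tile_b|ver_b]; last first.
  rewrite /entries_of; move: (ver_b); rewrite mem_cat negb_or => /andP[ov un].
  rewrite (negPf un) big_seq1 /passage_weight across_over (negPf ov) mul1r.
  exact: same_val.
move: sc {same_val vb}; case: s => i [k|d|] // in fit oc' out_b tile_b *.
move=> [l [_ [_ [r [/= sl [x [y [-> ->]]] ec ec']]]]].
(* A crossing: the orientations of the two strands and the end [b] leave finitely
   many cases, each of them an identity in the field. *)
have i_neq := gtn_eqF (ltnSn i); have i_neq' := ltn_eqF (ltnSn i).
have mid (w : coloring F) u v : w = [:: u; v] ->
    [/\ nth (false, 0) (l ++ w ++ r) i = u, nth (false, 0) (l ++ w ++ r) i.+1 = v &
        (i.+1 < size (l ++ w ++ r))%N].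
  move=> ->; rewrite -sl -addn1 nth_cat_addn -[in nth _ _ (size l)](addn0 (size l)).
  by rewrite nth_cat_addn; split=> //; rewrite !size_cat /=; lia.
have [cx cy szc] := mid _ x y (erefl _); rewrite -ec in cx cy szc.
have [x' [y' ecr]] : exists x' y', crossed t k x y = [:: x'; y'].
  by case: (k); do 2 eexists.
have [cx' cy' szc'] := mid _ x' y' ecr; rewrite -ec' in cx' cy' szc'.
have Cf0 : end_color c c' (false, i) = x by [].
have Cf1 : end_color c c' (false, i.+1) = y by [].
have Ct0 : end_color c c' (true, i) = x' by [].
have Ct1 : end_color c c' (true, i.+1) = y' by [].
have ebE a : end_boundary (orientations c) (i, Cross k) a =
    orientations (if a.1 then c' else c).
  by rewrite /end_boundary -oc'; case: ifP.
have szE q j : (j <= i.+1)%N -> (j < size (orientations (if q then c' else c)))%N.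
  by rewrite size_map => le_j; case: q; apply: leq_ltn_trans le_j _.
have inE' q j : (j <= i.+1)%N -> incoming (orientations c) (i, Cross k) (q, j) =
    ((end_color c c' (q, j)).1 == ~~ q).
  by move=> le_j; rewrite /incoming ebE szE//= nth_orientations.
have outE q j : (j <= i.+1)%N -> outgoing (orientations c) (i, Cross k) (q, j) ->
    (end_color c c' (q, j)).1 = q.
  by move=> le_j; rewrite /outgoing ebE szE//= nth_orientations => /eqP.
have pos : positive (orientations c) (i, Cross k) = (k == (x.1 == y.1)).
  by rewrite /positive !nth_orientations -Cf0 -Cf1.
have If0 := inE' false i (leqnSn i); have If1 := inE' false _ (leqnn i.+1).
have It0 := inE' true i (leqnSn i); have It1 := inE' true _ (leqnn i.+1).
have Of0 := outE false i (leqnSn i); have Of1 := outE false _ (leqnn i.+1).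
have Ot0 := outE true i (leqnSn i); have Ot1 := outE true _ (leqnn i.+1).
rewrite Cf0 in If0 Of0; rewrite Cf1 in If1 Of1;
rewrite Ct0 in It0 Ot0; rewrite Ct1 in It1 Ot1.
clear cx cy szc cx' cy' szc' ebE szE ec ec' inE' outE fit oc' mid sl l r.
move: x y => [ox vx] [oy vy] in ecr Cf0 Cf1 pos If0 If1 Of0 Of1 *.
rewrite /= in ecr If0 If1 It0 It1 Of0 Of1 Ot0 Ot1.
destruct k, ox, oy; rewrite /crossed /= in ecr; case: ecr => ex' ey';
  rewrite -{}ex' in Ct0 It0 Ot0; rewrite -{}ey' in Ct1 It1 Ot1;
  rewrite /= in Ct0 Ct1 It0 It1 Ot0 Ot1;
  move: tile_b; rewrite mem_cat !in_cons ?in_nil ?orbF => /orP[] /orP[] /eqP eb; subst b.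
all: try by [have := Of0 out_b | have := Of1 out_b | have := Ot0 out_b | have := Ot1 out_b].
all: rewrite /entries_of /= ?in_cons ?in_nil ?xpair_eqE /= ?i_neq ?i_neq' ?eqxx
  ?If0 ?If1 ?It0 ?It1 /=.
all: rewrite ?big_cons ?big_nil /passage_weight ?pos /= ?in_cons ?in_nil ?xpair_eqE
  /= ?i_neq ?i_neq' ?eqxx /= ?Cf0 ?Cf1 ?Ct0 ?Ct1 /=.
all: by rewrite ?i_neq ?i_neq'; field.
Qed.

Lemma trace_slice (F : fieldType) (t : F) c D T k : trace t c D T -> (k < size D)%N ->
  slice_colored t (slice_of D k) (nth [::] (c :: T) k) (nth [::] (c :: T) k.+1).
Proof.
elim: D c T k => [|s D IH] c [|c' T] [|k] //= [sc tr] lt_k //.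
exact: IH tr lt_k.
Qed.

Section Transfer.
Variables (F : fieldType) (t : F) (e : boundary) (D : diagram).

Definition weight (q : passage) : F :=
  passage_weight t (level e D q.1.1) (slice_of D q.1.1) q.1.2 q.2.

Definition transfer_mx : 'M[F]_((size (points e D)).+1) :=
  edge_mx (passages e D) (rank e D \o source) (rank e D \o target) weight.

(** The orientation of a point decides in which of the two adjacent slices it ends
    a passage; likewise below for the slice in which it begins one. *)
Lemma outgoing_inj k k' b b' : (k < size D)%N -> (k' < size D)%N ->
  outgoing (level e D k) (slice_of D k) b ->
  outgoing (level e D k') (slice_of D k') b' ->
  point_of k b = point_of k' b' -> k = k' /\ b = b'.
Proof.
move=> lt_k lt_k' /andP[_ +] /andP[_ +]; rewrite !end_boundary_level//.
case: b b' => [q p] [q' p'] /= /eqP eb /eqP eb' [ek ep].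
have eq : q = q' by rewrite -eb -eb' ek ep.
by move: ek; rewrite eq ep => /addIn.
Qed.

Lemma incoming_inj k k' a a' : (k < size D)%N -> (k' < size D)%N ->
  incoming (level e D k) (slice_of D k) a ->
  incoming (level e D k') (slice_of D k') a' ->
  point_of k a = point_of k' a' -> k = k' /\ a = a'.
Proof.
move=> lt_k lt_k' /andP[_ +] /andP[_ +]; rewrite !end_boundary_level//.
case: a a' => [q p] [q' p'] /= /eqP ea /eqP ea' [ek ep].
have eq : q = q' by apply: negb_inj; rewrite -ea -ea' ek ep.
by move: ek; rewrite eq ep => /addIn.
Qed.

Lemma sum_into (g : passage -> F) e' k b : well_formed e D e' -> (k < size D)%N ->
  outgoing (level e D k) (slice_of D k) b ->
  \sum_(q <- passages e D | rank e D (target q) == rank e D (point_of k b)) g q =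
  \sum_(a <- entries_of (level e D k) (slice_of D k) b) g (k, a, b).
Proof.
move=> wf lt_k out_b; have fit := well_formed_fits wf lt_k.
rewrite -big_filter.
have -> : \sum_(a <- entries_of (level e D k) (slice_of D k) b) g (k, a, b) =
  \sum_(q <- [seq (k, a, b) | a <- entries_of (level e D k) (slice_of D k) b]) g q.
  by rewrite big_map.
apply/perm_big/uniq_perm; first exact/filter_uniq/uniq_passages.
  by rewrite map_inj_uniq ?uniq_entries_of// => a a' [].
move=> [[k' a] b']; rewrite mem_filter mem_passages.
apply/andP/mapP => [[/eqP + /andP[lt_k' pass]]|[a' + [-> -> ->]]].
  have out_b' : outgoing (level e D k') (slice_of D k') b' by case/and3P: pass.
  have [_ tp] : is_point e D (point_of k' a) /\ is_point e D (point_of k' b').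
    by apply: (passage_points (q := (k', a, b'))); rewrite mem_passages lt_k'.
  move=> /(rank_inj tp) /(outgoing_inj lt_k' lt_k out_b' out_b)[ek eb].
  by rewrite -ek -eb; exists a; rewrite -?may_passE// ek.
by rewrite -may_passE// => pass; rewrite /target /= eqxx lt_k.
Qed.

Section Flow.
Variables (n : nat) (c : coloring F) (T : seq (coloring F)).
Hypotheses (t_neq0 : t != 0) (wf : well_formed e D (ups n)) (e_up : e = ups n)
  (oc : orientations c = e) (tr : trace t c D T).

Definition value_at (z : Defs.point) : F :=
  (nth (false, 0) (nth [::] (c :: T) z.1) z.2).2.

Lemma orientations_at k : (k <= size D)%N ->
  orientations (nth [::] (c :: T) k) = level e D k.
Proof. by move=> le_k; rewrite (trace_level tr le_k) oc. Qed.

(** A bottom point is oriented upwards, so that no passage arrives there; any other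
    point is an outgoing end of exactly one slice. *)
Lemma flow_at z : is_point e D z ->
  \sum_(q <- passages e D | rank e D (target q) == rank e D z)
     value_at (source q) * weight q = if z.1 == 0%N then 0 else value_at z.
Proof.
move=> zP; case: z zP => [[|k] p] zP /=.
  rewrite big1_seq// => -[[k a] b]; rewrite mem_passages.
  move=> /andP[/eqP ez /andP[lt_k pass]].
  have [_ tp] : is_point e D (point_of k a) /\ is_point e D (point_of k b).
    by apply: (passage_points (q := (k, a, b))); rewrite mem_passages lt_k.
  have {tp} [ek ep] := rank_inj tp ez.
  have /and3P[_ /andP[_ +] _] := pass.
  rewrite end_boundary_level// ek ep /level take0 /= e_up nth_nseq.
  case/andP: zP => _ /=; rewrite /level take0 /= e_up size_nseq => ->.
  by move: ek; case: b.1; rewrite // addn1.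
have {zP} [lek ltp] : (k.+1 <= size D)%N /\ (p < size (level e D k.+1))%N.
  by case/andP: zP.
have [k' [b [lt_k' out_b eb]]] : exists k' b, [/\ (k' < size D)%N,
    outgoing (level e D k') (slice_of D k') b & point_of k' b = (k.+1, p)].
  case ori : (nth false (level e D k.+1) p).
    exists k, (true, p); rewrite /outgoing end_boundary_level// /point_of /= addn1.
    by rewrite ltp ori.
  exists k.+1, (false, p); move: lek; rewrite leq_eqVlt => /predU1P[ek|lt_k].
    move: ori ltp; rewrite ek (well_formed_top wf) size_nseq nth_nseq.
    by case: ifP.
  by rewrite /outgoing end_boundary_level// /point_of /= addn0 ltp ori.
have oc' := orientations_at (ltnW lt_k').
rewrite -eb (sum_into _ wf lt_k' out_b).
have := flow_local t_neq0 (trace_slice tr lt_k'); rewrite oc' => /(_ _ out_b).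
have col a : (end_color (nth [::] (c :: T) k') (nth [::] (c :: T) k'.+1) a).2 =
    value_at (point_of k' a).
  by rewrite /end_color /value_at; case: a => [[] q] /=; rewrite ?addn1 ?addn0.
rewrite col => <-; apply: eq_bigr => a _.
by rewrite col mulrC.
Qed.

Definition flow : 'rV[F]_((size (points e D)).+1) :=
  \row_i value_at (point_at i).

(** The part of the flow that does not come through a passage. *)
Definition inflow : 'rV[F]_((size (points e D)).+1) :=
  \row_i if (point_at i).1 == 0%N then value_at (point_at i) else 0.

Lemma flow_eq : flow *m (1%:M - transfer_mx) = inflow.
Proof.
apply/rowP => i; rewrite mulmxBr mulmx1 mxE [X in _ + X]mxE mul_mx_edge !mxE.
case: (ltnP i (size (points e D))) => [lt_i|le_i].
  have [zP /esym ei] := rank_point_at lt_i.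
  rewrite {2}ei; under eq_bigr => q do rewrite mxE.
  have -> : \sum_(q <- passages e D | (rank e D \o target) q == rank e D (point_at i))
       value_at (point_at ((rank e D \o source) q)) * weight q =
     \sum_(q <- passages e D | rank e D (target q) == rank e D (point_at i))
       value_at (source q) * weight q.
    rewrite big_seq_cond [RHS]big_seq_cond; apply: eq_bigr => q /andP[qP _].
    by rewrite /= point_at_rank// (passage_points qP).1.
  by rewrite flow_at//; case: ifP => _; rewrite ?subr0 ?subrr.
rewrite [point_at i]nth_default//= /value_at /= [nth [::] T _]nth_default; last first.
  by rewrite (trace_size tr).
rewrite nth_nil /= sub0r big1_seq ?oppr0// => q /andP[/eqP /(congr1 val) + qP].
rewrite /= inordK ?ltnS ?index_size// => ei.
by move: le_i; rewrite -ei leqNgt index_mem mem_points (passage_points qP).2.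
Qed.

End Flow.
End Transfer.

(** * String links at t = 1 *)

Lemma passage_weight1 (F : fieldType) e s a b : may_pass e s a b ->
  passage_weight (1 : F) e s a b = (b == across s a)%:R.
Proof.
case/and3P => _ _; rewrite /passage_weight invr1 if_same subrr.
case: (b == across s a) => /= [_|/andP[-> _]//].
by rewrite if_same.
Qed.

Section Nilpotency.
Variables (F : fieldType) (n : nat) (D : diagram).
Hypothesis link : string_link n D.
Let e := ups n.
Let wf : well_formed e D e := link.1.
Let W : 'M[F]_((size (points e D)).+1) := transfer_mx 1 e D.

(** At 1 a path that enters at [a] has only one continuation of nonzero weight,
    along the strand. *)
Lemma transfer1_step p (A : 'M[F]_(_, p)) k a j : (k < size D)%N ->
  incoming (level e D k) (slice_of D k) a ->
  (W *m A) (rank e D (point_of k a)) j =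
  A (rank e D (point_of k (across (slice_of D k) a))) j.
Proof.
move=> lt_k in_a; have fit := well_formed_fits wf lt_k.
pose q0 := (k, a, across (slice_of D k) a).
have pass0 : may_pass (level e D k) (slice_of D k) a (across (slice_of D k) a).
  by rewrite /may_pass in_a outgoing_across// in_a eqxx.
have q0P : q0 \in passages e D by rewrite mem_passages lt_k.
rewrite /W mul_edge_mx -big_filter (bigD1_seq q0)/=; first last.
- exact/filter_uniq/uniq_passages.
- by rewrite mem_filter /= eqxx.
rewrite big1_seq ?addr0.
  by rewrite /weight /= passage_weight1// eqxx mul1r.
move=> [[k' a'] b] /andP[neq]; rewrite mem_filter mem_passages.
move=> /andP[/eqP es /andP[lt_k' pass]].
have in_a' : incoming (level e D k') (slice_of D k') a' by case/and3P: pass.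
have [sp _] : is_point e D (point_of k' a') /\ is_point e D (point_of k' b).
  by apply: (passage_points (q := (k', a', b))); rewrite mem_passages lt_k'.
have [ek ea] := incoming_inj lt_k' lt_k in_a' in_a (rank_inj sp es).
rewrite /weight /= passage_weight1//.
case: eqP => [eb|_]; last by rewrite mul0r.
by move: neq; rewrite eb ek ea eqxx.
Qed.

(** Walks from [x] along the strands stop: a top point does this at once, and [x]
    does it iff its successor does, so that the property is constant along a
    component. *)
Definition dies_out (x : Defs.point) : Prop :=
  exists r, forall j, (W ^+ r) (rank e D x) j = 0.

Lemma dies_out_across k a : (k < size D)%N ->
  incoming (level e D k) (slice_of D k) a ->
  dies_out (point_of k a) <-> dies_out (point_of k (across (slice_of D k) a)).
Proof.
move=> lt_k in_a; have step r j : (W ^+ r.+1) (rank e D (point_of k a)) j =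
    (W ^+ r) (rank e D (point_of k (across (slice_of D k) a))) j.
  by rewrite exprS -(transfer1_step _ _ lt_k in_a).
split=> -[r dr]; last by exists r.+1 => j; rewrite step.
exists r => j; rewrite -step exprSr.
by rewrite -mulmxE mxE big1// => i _; rewrite dr mul0r.
Qed.

Lemma dies_out_joined x y : joined e D x y -> dies_out x <-> dies_out y.
Proof.
move=> [k [a [lt_k va -> ->]]].
have fit := well_formed_fits wf lt_k.
case: (boolP (incoming (level e D k) (slice_of D k) a)) => [in_a|].
  exact: dies_out_across.
rewrite /incoming va /= => ori.
have in_a : incoming (level e D k) (slice_of D k) (across (slice_of D k) a).
  rewrite incoming_across// /outgoing va /=; move: ori.
  by case: nth; case: a.1.
by rewrite (dies_out_across lt_k in_a) acrossK.
Qed.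

Lemma dies_out_top (j : 'I_n) : dies_out (size D, nat_of_ord j).
Proof.
exists 1%N => i; rewrite expr1 mxE big1_seq// => -[[k a] b] /= /andP[/andP[/eqP es _]].
rewrite mem_passages => /andP[lt_k pass].
have [sp _] : is_point e D (point_of k a) /\ is_point e D (point_of k b).
  by apply: (passage_points (q := (k, a, b))); rewrite mem_passages lt_k.
have [ek ea] := rank_inj sp es.
have /and3P[/andP[_ +] _ _] := pass.
rewrite end_boundary_level// ek ea (well_formed_top wf) nth_nseq ltn_ord.
by move: ek lt_k; case: a.1 => //=; rewrite addn0 => ->; rewrite ltnn.
Qed.

Lemma dies_out_point x : is_point e D x -> dies_out x.
Proof.
move=> /link.2[_ [j [xj _]]].
suff : dies_out x <-> dies_out (size D, nat_of_ord j) by move=> ->; exact: dies_out_top.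
elim: xj => {x} [x y /dies_out_joined//|//|x y _ <-//|x y z _ -> _ ->//].
Qed.

Lemma transfer1_nilpotent : exists r, W ^+ r = 0.
Proof.
apply: expmx_rows0 => i; case: (ltnP i (size (points e D))) => [lt_i|le_i].
  have [zP <-] := rank_point_at lt_i.
  exact: dies_out_point zP.
exists 1%N => j; rewrite expr1 mxE big1_seq// => q /= /andP[/andP[/eqP /(congr1 val) + _] qP].
rewrite /= inordK ?ltnS ?index_size// => ei.
by move: le_i; rewrite -ei leqNgt index_mem mem_points (passage_points qP).1.
Qed.

End Nilpotency.

(** * Colorings of string links *)

Section Output.
Variables (F : fieldType) (t : F) (n : nat) (D : diagram).
Hypotheses (t_neq0 : t != 0) (wf : well_formed (ups n) D (ups n)).
Let W := transfer_mx t (ups n) D.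
Hypothesis unitW : 1%:M - W \in unitmx.

Lemma flow_solved (c : coloring F) T : orientations c = ups n -> trace t c D T ->
  flow (ups n) D c T = inflow (ups n) D c T *m invmx (1%:M - W).
Proof.
by move=> oc tr; rewrite -(flow_eq t_neq0 wf (erefl _) oc tr) mulmxK.
Qed.

Lemma flow_rank (c : coloring F) T z : is_point (ups n) D z ->
  flow (ups n) D c T 0 (rank (ups n) D z) = value_at c T z.
Proof. by move=> zP; rewrite mxE point_at_rank. Qed.

Lemma unit_determined : determined t (ups n) D.
Proof.
move=> c T T' oc tr tr'.
have ein : inflow (ups n) D c T = inflow (ups n) D c T'.
  apply/rowP => i; rewrite !mxE; case: eqP => // ez.
  by rewrite /value_at ez.
have ef : flow (ups n) D c T = flow (ups n) D c T'.
  by rewrite !flow_solved// ein.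
have sT := trace_size tr; have sT' := trace_size tr'.
apply: (@eq_from_nth _ [::]) => [|k]; first by rewrite sT.
rewrite sT => lt_k.
have o := trace_level tr lt_k; have o' := trace_level tr' lt_k.
rewrite -[nth _ T _]/(nth _ (c :: T) k.+1) -[nth _ T' _]/(nth _ (c :: T') k.+1).
have so (w : coloring F) : orientations w = level (orientations c) D k.+1 ->
    size w = size (level (ups n) D k.+1).
  by rewrite -oc => <-; rewrite size_map.
apply: (@eq_from_nth _ (false, 0)) => [|p]; first by rewrite !so.
rewrite so// => lt_p; apply: injective_projections.
  by rewrite -!nth_orientations o o'.
have zP : is_point (ups n) D (k.+1, p) by apply/andP.
have := congr1 (fun f : 'rV_(_) => f 0 (rank (ups n) D (k.+1, p))) ef.
by rewrite !flow_rank.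
Qed.

(** The bottom values being those of a basis vector, the flow is a row of the
    inverse of 1 - W. *)
Lemma output_entry (i j : 'I_n) T (v : 'cV[F]_n) :
  trace t (upward (entries (delta_mx i 0))) D T ->
  last (upward (entries (delta_mx i 0))) T = upward (entries v) ->
  v j 0 = invmx (1%:M - W) (rank (ups n) D (0%N, nat_of_ord i))
                           (rank (ups n) D (size D, nat_of_ord j)).
Proof.
set c := upward _ => tr eT.
have oc : orientations c = ups n by rewrite orientations_upward size_entries.
have topP : is_point (ups n) D (size D, nat_of_ord j).
  by rewrite /is_point /= leqnn (well_formed_top wf) size_nseq ltn_ord.
have botP : is_point (ups n) D (0%N, nat_of_ord i).
  by rewrite /is_point /= /level take0 size_nseq ltn_ord.
have := congr1 (fun f : 'rV_(_) => f 0 (rank (ups n) D (size D, nat_of_ord j)))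
  (flow_solved oc tr).
rewrite flow_rank// /value_at /= -(trace_size tr).
have -> : nth [::] (c :: T) (size T) = upward (entries v).
  by rewrite -eT (last_nth [::]).
rewrite (nth_map 0) ?size_entries// nth_entries /= => ->.
have -> : inflow (ups n) D c T = delta_mx 0 (rank (ups n) D (0%N, nat_of_ord i)).
  apply/rowP => r; rewrite !mxE /=.
  have [lt_r|le_r] := ltnP r (size (points (ups n) D)); last first.
    rewrite [point_at r]nth_default//=; case: eqP => // er.
    move: le_r; rewrite er inordK ?ltnS ?index_size//.
    by rewrite leqNgt index_mem mem_points botP.
  have [zP /esym er] := rank_point_at lt_r.
  rewrite [in RHS]er; move: (point_at r) zP => {er lt_r} [k p] zP /=.
  have -> : (rank (ups n) D (k, p) == rank (ups n) D (0%N, nat_of_ord i)) =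
      ((k, p) == (0%N, nat_of_ord i)).
    by apply/eqP/eqP => [/(rank_inj zP)|->].
  rewrite xpair_eqE; case: eqP zP => //= -> /andP[_ /=].
  rewrite /level take0 /= size_nseq => lt_p; rewrite /value_at /=.
  rewrite (nth_map 0) ?size_entries//= (nth_entries _ _ (Ordinal lt_p)) mxE.
  by rewrite eqxx andbT -val_eqE.
by rewrite -rowE mxE (trace_size tr).
Qed.

End Output.

(** * Contractions and geometric series of matrices *)

Local Open Scope classical_set_scope.

Lemma cvg_sum_seq (R : realType) (I T : Type) (F : set_system T) (r : seq I)
    (P : pred I) (f : I -> T -> R) (a : I -> R) : Filter F ->
  (forall i, P i -> f i x @[x --> F] --> a i) ->
  \sum_(i <- r | P i) f i x @[x --> F] --> \sum_(i <- r | P i) a i.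
Proof. by move=> FF; apply: cvg_big; exact: add_continuous. Qed.

Section Contraction.
Variables (R : realType) (N : nat) (W U : 'M[R]_N) (h : 'cV[R]_N).
Hypotheses (h_ge1 : forall i, 1 <= h i 0)
  (W_le_U : forall i j, `|W i j| <= U i j)
  (Uh : forall i, (U *m h) i 0 <= h i 0 / 2).

(** [U] halves [h], and [W] is dominated by [U]: the L-th power of [W] is bounded by
    [h / 2 ^+ L]. *)
Lemma contraction_bound n i j : `|(W ^+ n) i j| <= h i 0 / 2 ^+ n.
Proof.
elim: n i => [|n IH] i.
  rewrite expr0 mxE divr1; apply: le_trans (h_ge1 i).
  by case: (i == j); rewrite ?normr1 ?normr0.
rewrite exprS -mulmxE mxE; apply: le_trans (ler_norm_sum _ _ _) _.
apply: (@le_trans _ _ (\sum_k U i k * h k 0 / 2 ^+ n)).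
  by apply: ler_sum => k _; rewrite normrM -mulrA ler_pM.
have := Uh i; rewrite mxE -mulr_suml => Uhi.
by rewrite ler_pdivrMr ?exprn_gt0// exprS invfM mulrA divfK ?expf_neq0// pnatr_eq0.
Qed.

Lemma contraction_cvg0 i j : (W ^+ n) i j @[n --> \oo] --> (0 : R).
Proof.
apply/norm_cvg0P.
apply: (@squeeze_cvgr _ _ _ _ (fun=> 0) (fun n => h i 0 * 2^-1 ^+ n)).
- by near=> n; rewrite /= exprVn normr_ge0 contraction_bound.
- exact: cvg_cst.
- have := @cvg_geometric R (h i 0) 2^-1; apply.
  by rewrite ger0_norm ?invr_ge0// invf_lt1// ltr1n.
Unshelve. all: by end_near. Qed.

(** A vector fixed by [W] is fixed by its powers, which tend to zero. *)
Lemma contraction_unit : 1%:M - W \in unitmx.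
Proof.
rewrite -unitmx_tr -row_free_unit; apply: inj_row_free => x.
move=> /(congr1 trmx); rewrite trmx_mul trmxK trmx0 mulmxBl mul1mx.
move=> /subr0_eq Wx.
have Wnx n : x^T = W ^+ n *m x^T.
  elim: n => [|n IH]; first by rewrite expr0 mul1mx.
  by rewrite exprSr -mulmxA -Wx.
apply/rowP => i; rewrite [RHS]mxE.
have cvgx : x 0 i @[n --> \oo] --> (0 : R).
  have -> : (fun _ : nat => x 0 i) = (fun n => \sum_k (W ^+ n) i k * x 0 k).
    apply/funext => n; have /(congr1 (fun v : 'cV[R]_N => v i 0)) := Wnx n.
    by rewrite !mxE => ->; apply: eq_bigr => k _; rewrite mxE.
  rewrite [X in _ --> X](_ : 0 = \sum_(k < N) 0 * x 0 k); last first.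
    by rewrite big1// => k _; rewrite mul0r.
  apply: cvg_sum_seq.
  by move=> k _; apply: cvgMr_tmp; exact: contraction_cvg0.
by apply: cvg_unique cvgx => //; exact: cvg_cst.
Qed.

Lemma contraction_series i j :
  \sum_(0 <= n < m) (W ^+ n) i j @[m --> \oo] --> invmx (1%:M - W) i j.
Proof.
have sumE m : \sum_(0 <= n < m) (W ^+ n) i j =
    invmx (1%:M - W) i j - \sum_k invmx (1%:M - W) i k * (W ^+ m) k j.
  have geo : (1%:M - W) *m (\sum_(0 <= n < m) W ^+ n) = 1%:M - W ^+ m.
    rewrite big_mkord; have := congr1 (@GRing.opp _) (subrX1 W m).
    by rewrite opprB -mulNr opprB => /esym.
  have := mulKmx contraction_unit (\sum_(0 <= n < m) W ^+ n).
  rewrite geo mulmxBr mulmx1 => /(congr1 (fun A : 'M[R]_N => A i j)).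
  by rewrite summxE => <-; rewrite !mxE.
rewrite (_ : (fun m => _) = fun m => invmx (1%:M - W) i j -
    \sum_k invmx (1%:M - W) i k * (W ^+ m) k j); last exact/funext.
rewrite -[in X in _ --> X](subr0 (invmx _ _ _)); apply: cvgB; first exact: cvg_cst.
rewrite [X in _ --> X](_ : 0 = \sum_(k < N) invmx (1%:M - W) i k * 0); last first.
  by rewrite big1// => k _; rewrite mulr0.
apply: cvg_sum_seq.
by move=> k _; apply: cvgMl_tmp; exact: contraction_cvg0.
Qed.

End Contraction.

(** With [B := 2 *: A], the vector [h := \sum_k B ^+ k *m 1] solves [h = 1 + B h],
    that is [A h = (h - 1) / 2]. *)
Lemma nilpotent_potential (R : realType) N (A : 'M[R]_N) r :
  (forall i j, 0 <= A i j) -> A ^+ r = 0 ->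
  exists h : 'cV[R]_N, forall i, 1 <= h i 0 /\ (A *m h) i 0 < h i 0 / 2.
Proof.
move=> A_ge0 Ar; pose B := 2 *: A.
pose S := \sum_(k < r.+1) B ^+ k; pose one : 'cV[R]_N := const_mx 1.
have Bk k : B ^+ k = 2 ^+ k *: A ^+ k.
  elim: k => [|k IH]; first by rewrite !expr0 scale1r.
  by rewrite !exprS IH -!mulmxE -scalemxAr -scalemxAl scalerA mulrC.
have Br : B ^+ r.+1 = 0 by rewrite Bk (exprS A) Ar mulr0 scaler0.
have BS : B *m S = S - 1%:M.
  have := subrX1 B r.+1; rewrite Br -mulmxE mulmxBl mul1mx -/S => e.
  by apply/eqP; rewrite eq_sym subr_eq addrC -subr_eq -[_ - _]opprB -e sub0r opprK.
have Bk_ge0 k i j : 0 <= (B ^+ k) i j.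
  elim: k i => [|k IH] i; first by rewrite expr0 mxE ler0n.
  rewrite exprS -mulmxE mxE sumr_ge0// => l _; rewrite mulr_ge0//.
  by rewrite mxE mulr_ge0.
exists (S *m one) => i.
have S_ge1 : 1 <= (S *m one) i 0.
  rewrite mulmx_suml summxE big_ord_recl expr0 mul1mx [const_mx _ _ _]mxE.
  rewrite lerDl sumr_ge0// => k _; rewrite mxE sumr_ge0// => l _.
  by rewrite mulr_ge0// mxE.
split=> //; have : (B *m (S *m one)) i 0 = (S *m one) i 0 - 1.
  by rewrite mulmxA BS mulmxBl mul1mx mxE [X in _ + X]mxE [one _ _]mxE.
by rewrite -scalemxAl mxE ltr_pdivlMr// mulrC => ->; rewrite gtrDl oppr_lt0.
Qed.

(** * Evaluation of rational functions *)

(** Stated for abstract fields, so that the construction of the field of fractions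
    stays folded. *)
Lemma rmorph_addf_div (A : comNzRingType) (K : fieldType) (phi : {rmorphism A -> K})
    (p q p' q' : A) : phi q != 0 -> phi q' != 0 ->
  phi p / phi q + phi p' / phi q' = phi (p * q' + p' * q) / phi (q * q').
Proof. by move=> q0 q'0; rewrite addf_div// rmorphD !rmorphM. Qed.

Lemma rmorph_mulf_div (A : comNzRingType) (K : fieldType) (phi : {rmorphism A -> K})
    (p q p' q' : A) :
  phi p / phi q * (phi p' / phi q') = phi (p * p') / phi (q * q').
Proof. by rewrite mulf_div !rmorphM. Qed.

Definition polynomial_fraction : {rmorphism {poly rat} -> Qt} :=
  @FracField.tofrac {poly rat}.

Section Values.
Variable (R : realType).
Implicit Types (f g : Qt) (x v w : R).

Lemma value_denominator (q : {poly rat}) x :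
  (map_poly ratr q).[x] != 0 -> FracField.tofrac q != 0.
Proof.
apply: contraNneq => /eqP; rewrite tofrac_eq0 => /eqP->.
by rewrite rmorph0 horner0.
Qed.

Lemma has_valueD f g x v w : has_value f x v -> has_value g x w ->
  has_value (f + g) x (v + w).
Proof.
move=> [p [q [-> q0 ->]]] [p' [q' [-> q'0 ->]]].
exists (p * q' + p' * q), (q * q'); split.
- exact: (rmorph_addf_div (phi := polynomial_fraction) p p'
    (value_denominator q0) (value_denominator q'0)).
- by rewrite rmorphM hornerM mulf_neq0.
- by rewrite addf_div// !rmorphD !rmorphM/= hornerD !hornerM.
Qed.

Lemma has_valueM f g x v w : has_value f x v -> has_value g x w ->
  has_value (f * g) x (v * w).
Proof.
move=> [p [q [-> q0 ->]]] [p' [q' [-> q'0 ->]]].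
exists (p * p'), (q * q'); split.
- exact: (rmorph_mulf_div polynomial_fraction p q p' q').
- by rewrite rmorphM hornerM mulf_neq0.
- by rewrite mulf_div !rmorphM/= !hornerM.
Qed.

Lemma has_valueV f x v : v != 0 -> has_value f x v -> has_value f^-1 x v^-1.
Proof.
move=> + [p [q [-> q0 ev]]]; rewrite ev => v0; exists q, p.
rewrite !invf_div; split=> //.
by apply: contraNneq v0 => ->; rewrite mul0r.
Qed.

Lemma has_value_poly (p : {poly rat}) x :
  has_value (FracField.tofrac p) x (map_poly ratr p).[x].
Proof.
by exists p, 1; rewrite tofrac1 rmorph1 hornerC !divr1 oner_neq0.
Qed.

Lemma has_value0 x : has_value 0 x 0.
Proof. by have := has_value_poly 0 x; rewrite tofrac0 rmorph0 horner0. Qed.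

Lemma has_value1 x : has_value 1 x 1.
Proof. by have := has_value_poly 1 x; rewrite tofrac1 rmorph1 hornerC. Qed.

Lemma has_valueX x : has_value qt x x.
Proof. by have := has_value_poly 'X x; rewrite map_polyX hornerX. Qed.

Lemma has_valueN f x v : has_value f x v -> has_value (- f) x (- v).
Proof.
move=> fv; rewrite -mulN1r -[- v]mulN1r; apply: has_valueM => //.
by have := has_value_poly (-1) x; rewrite tofracN tofrac1 rmorphN rmorph1 hornerN hornerC.
Qed.

Lemma has_value_eq0 x v : has_value 0 x v -> v = 0.
Proof.
move=> [p [q [e q0 ->]]]; move/eqP: e; rewrite eq_sym mulf_eq0 invr_eq0.
rewrite (negPf (value_denominator q0)) orbF tofrac_eq0 => /eqP->.
by rewrite rmorph0 horner0 mul0r.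
Qed.

Lemma has_value_sign (k : nat) x : has_value ((-1) ^+ k) x ((-1) ^+ k).
Proof.
elim: k => [|k IH]; first exact: has_value1.
by rewrite !exprS; apply: has_valueM => //; exact/has_valueN/has_value1.
Qed.

Lemma has_value_sum (I : Type) (r : seq I) (P : pred I) (f : I -> Qt) (v : I -> R) x :
  (forall i, has_value (f i) x (v i)) ->
  has_value (\sum_(i <- r | P i) f i) x (\sum_(i <- r | P i) v i).
Proof.
move=> fv; apply: (big_ind2 (fun g w => has_value g x w)) => //.
  exact: has_value0.
by move=> *; apply: has_valueD.
Qed.

Lemma has_value_prod (I : Type) (r : seq I) (P : pred I) (f : I -> Qt) (v : I -> R) x :
  (forall i, has_value (f i) x (v i)) ->
  has_value (\prod_(i <- r | P i) f i) x (\prod_(i <- r | P i) v i).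
Proof.
move=> fv; apply: (big_ind2 (fun g w => has_value g x w)) => //.
  exact: has_value1.
by move=> *; apply: has_valueM.
Qed.

Definition mx_value m n (A : 'M[Qt]_(m, n)) x (B : 'M[R]_(m, n)) : Prop :=
  forall i j, has_value (A i j) x (B i j).

Lemma mx_value_det n (A : 'M[Qt]_n) x (B : 'M[R]_n) : mx_value A x B ->
  has_value (\det A) x (\det B).
Proof.
move=> AB; apply: has_value_sum => s; apply: has_valueM.
  exact: has_value_sign.
exact: has_value_prod.
Qed.

(** The determinant of [A] takes a nonzero value at [x]. *)
Lemma mx_value_unit n (A : 'M[Qt]_n) x (B : 'M[R]_n) : mx_value A x B ->
  B \in unitmx -> A \in unitmx.
Proof.
move=> /mx_value_det AB; rewrite !unitmxE !unitfE; apply: contraNneq => e.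
by move: AB; rewrite e => /has_value_eq0 ->.
Qed.

Lemma mx_value_inv n (A : 'M[Qt]_n) x (B : 'M[R]_n) : mx_value A x B ->
  B \in unitmx -> mx_value (invmx A) x (invmx B).
Proof.
move=> AB uB i j; have uA := mx_value_unit AB uB.
rewrite /invmx uA uB !mxE; apply: has_valueM.
  by apply: has_valueV (mx_value_det AB); rewrite -unitfE -unitmxE.
apply: has_valueM; first exact: has_value_sign.
by apply: mx_value_det => k l; rewrite !mxE.
Qed.

Lemma has_value_passage e s a b x : x != 0 ->
  has_value (passage_weight qt e s a b) x (passage_weight x e s a b).
Proof.
move=> x0; rewrite /passage_weight.
have vu : has_value (if positive e s then qt else qt^-1) x
                    (if positive e s then x else x^-1).
  case: ifP => _; first exact: has_valueX.
  exact/(has_valueV x0)/has_valueX.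
case: ifP => _; last exact: has_value1.
by case: ifP => _ //; apply: has_valueD; [exact: has_value1 | exact: has_valueN].
Qed.

Lemma transfer_value e D x : x != 0 ->
  mx_value (1%:M - transfer_mx qt e D) x (1%:M - transfer_mx x e D).
Proof.
move=> x0 i j; rewrite !mxE; apply: has_valueD.
  by case: (i == j); [exact: has_value1 | exact: has_value0].
by apply/has_valueN/has_value_sum => q; exact: has_value_passage.
Qed.

End Values.

(** * Path sums near t = 1 *)

Section Near1.
Variables (R : realType) (n : nat) (D : diagram).
Hypothesis link : string_link n D.
Let e := ups n.
Let W (x : R) := transfer_mx x e D.
Let U (x : R) := edge_mx (passages e D) (rank e D \o source) (rank e D \o target)
  (fun q => `|weight x e D q|).

Lemma transfer_qt_unit : 1%:M - transfer_mx qt e D \in unitmx.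
Proof.
have value1 := transfer_value (e := e) (D := D) (oner_neq0 R).
have [r Wr] := transfer1_nilpotent R link.
exact: mx_value_unit value1 (nilpotent_unit Wr).
Qed.

Lemma weight_cvg q : weight x e D q @[x --> (1 : R)] --> weight (1 : R) e D q.
Proof.
rewrite /weight /passage_weight.
have cu : (if positive (level e D q.1.1) (slice_of D q.1.1) then x else x^-1)
    @[x --> (1 : R)] -->
    (if positive (level e D q.1.1) (slice_of D q.1.1) then 1 else 1^-1 : R).
  by case: ifP => _; [exact: cvg_id | apply: cvgV; [exact: oner_neq0 | exact: cvg_id]].
case: ifP => _; last exact: cvg_cst.
by case: ifP => _ //; apply: cvgB => //; exact: cvg_cst.
Qed.

(** The potential of the nilpotent matrix at 1 satisfies strict inequalities, which
    persist nearby by continuity of the weights. *)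
Lemma near1_contraction : exists h : 'cV[R]_((size (points e D)).+1),
  (forall i, 1 <= h i 0) /\
  \forall x \near (1 : R), forall i, (U x *m h) i 0 <= h i 0 / 2.
Proof.
have [r Wr] := transfer1_nilpotent R link.
have UW : U 1 = W 1.
  apply/matrixP => i j; rewrite !mxE big_seq_cond [RHS]big_seq_cond.
  apply: eq_bigr => -[[k a] b] /andP[]; rewrite mem_passages => /andP[_ pass] _.
  by rewrite /weight /= passage_weight1// ger0_norm.
have U_ge0 i j : 0 <= U 1 i j by rewrite mxE sumr_ge0.
rewrite -/(W 1) -UW in Wr.
have [h hP] := nilpotent_potential U_ge0 Wr.
exists h; split=> [i|]; first by case: (hP i).
suff near_i i : \forall x \near (1 : R), (U x *m h) i 0 <= h i 0 / 2.
  have := @filter_forall R _ (fun i x => is_true ((U x *m h) i 0 <= h i 0 / 2))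
    (nbhs (1 : R)) _ near_i.
  exact.
have [_ lt_i] := hP i.
have cU : (U x *m h) i 0 @[x --> (1 : R)] --> (U 1 *m h) i 0.
  rewrite mul_edge_mx; have -> : (fun x => (U x *m h) i 0) = fun x =>
      \sum_(q <- passages e D | (rank e D \o source) q == i)
        `|weight x e D q| * h ((rank e D \o target) q) 0.
    by apply/funext => x; rewrite mul_edge_mx.
  apply: cvg_sum_seq => q _; apply: cvgMr_tmp.
  by apply: cvg_norm; exact: weight_cvg.
by near=> x; apply/ltW; near: x; exact: cvgr_lt cU _ lt_i.
Unshelve. all: by end_near. Qed.

End Near1.

Section PathSums.
Variables (R : realType) (E : choiceType) (N : nat) (edges : seq E).
Variables (src tgt : E -> 'I_N) (i j : 'I_N).
Hypothesis uniq_edges : uniq edges.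

(** Walks are summed by length: there are finitely many of each length. *)
Lemma esum_walks (g : seq E -> R) (v : R) : (forall P, 0 <= g P) ->
  \sum_(0 <= L < m) \sum_(P <- walks edges src tgt L i j) g P @[m --> \oo] --> v ->
  (\esum_(P in [set P | is_walk edges src tgt i P j]) (g P)%:E = v%:E)%E.
Proof.
move=> g_ge0 g_cvg.
have -> : [set P | is_walk edges src tgt i P j] =
    \bigcup_L [set` walks edges src tgt L i j].
  apply/seteqP; split=> [P /= wP|P [L _] /=]; last by rewrite mem_walks => /andP[].
  by exists (size P) => //=; rewrite mem_walks eqxx.
rewrite nneseries_sum_bigcup; last 2 first.
- by move=> L L' _ _ [P [/=]]; rewrite !mem_walks => /andP[/eqP <- _] /andP[/eqP <- _].
- by move=> P; rewrite lee_fin.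
transitivity (\sum_(0 <= L <oo) (\sum_(P <- walks edges src tgt L i j) g P)%:E)%E.
  apply: eq_eseriesr => L _.
  rewrite esum_fset; [|exact: finite_seq|by move=> P _; rewrite lee_fin].
  by rewrite -fsbig_seq ?uniq_walks// sumEFin.
apply: cvg_lim => //; have -> : (fun m =>
    \sum_(0 <= L < m) (\sum_(P <- walks edges src tgt L i j) g P)%:E)%E =
    EFin \o (fun m => \sum_(0 <= L < m) \sum_(P <- walks edges src tgt L i j) g P).
  by apply/funext => m; rewrite /= sumEFin.
by apply: cvg_EFin => //; exact: nearW.
Qed.

Lemma walks_has_sum (wt : E -> R) (h : 'cV[R]_N) :
  let W := edge_mx edges src tgt wt in
  let U := edge_mx edges src tgt (fun q => `|wt q|) in
  (forall k, 1 <= h k 0) -> (forall k, (U *m h) k 0 <= h k 0 / 2) ->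
  has_sum [set P | is_walk edges src tgt i P j] (fun P => \prod_(q <- P) wt q)
    (invmx (1%:M - W) i j).
Proof.
move=> W U h_ge1 Uh.
have W_le_U k l : `|W k l| <= U k l by rewrite !mxE ler_norm_sum.
have U_le_U k l : `|U k l| <= U k l by rewrite ger0_norm// mxE sumr_ge0.
have cW := contraction_series h_ge1 W_le_U Uh (i := i) (j := j).
have cU := contraction_series h_ge1 U_le_U Uh (i := i) (j := j).
set f := fun P : seq E => \prod_(q <- P) wt q.
have sum_f L : \sum_(P <- walks edges src tgt L i j) f P = (W ^+ L) i j.
  exact: sum_walks.
have sum_nf L : \sum_(P <- walks edges src tgt L i j) `|f P| = (U ^+ L) i j.
  by rewrite -sum_walks; apply: eq_bigr => P _; rewrite normr_prod.
split.
  rewrite /summable; under eq_esum do rewrite abse_EFin.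
  rewrite (esum_walks (v := invmx (1%:M - U) i j)) ?ltry//.
  by under eq_fun do under eq_bigr do rewrite sum_nf.
(* The positive and the negative part of f are (|f| + s f) / 2 for s = 1 and -1;
   hence their sums by length are combinations of entries of powers of U and W. *)
have half (s : R) : `|s| = 1 -> 
  (\esum_(P in [set P | is_walk edges src tgt i P j]) (maxe (s * f P)%:E 0) =
   ((invmx (1%:M - U) i j + s * invmx (1%:M - W) i j) / 2)%:E)%E.
  move=> s1.
  have maxE P : (maxe (s * f P)%:E 0 = ((`|f P| + s * f P) / 2)%:E)%E.
    have -> : `|f P| = `|s * f P| by rewrite normrM s1 mul1r.
    rewrite -EFin_max; congr (_%:E); case: (leP 0 (s * f P)) => fs.
      by rewrite ger0_norm//; lra.
    by rewrite ltr0_norm//; lra.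
  under eq_esum do rewrite maxE; apply: esum_walks.
    move=> P; rewrite divr_ge0// -lerBlDr sub0r.
    by rewrite (le_trans (ler_norm _))// normrN normrM s1 mul1r.
  have -> : (fun m => \sum_(0 <= L < m) \sum_(P <- walks edges src tgt L i j)
       (`|f P| + s * f P) / 2) =
     fun m => (\sum_(0 <= L < m) (U ^+ L) i j + s * \sum_(0 <= L < m) (W ^+ L) i j) / 2.
    apply/funext => m; rewrite mulr_sumr -big_split/= mulr_suml.
    apply: eq_bigr => L _; rewrite -sum_f -sum_nf mulr_sumr -big_split/= mulr_suml.
    by [].
  by apply: cvgMr_tmp; apply: cvgD => //; apply: cvgMl_tmp.
have := half 1 (normr1 _); have := half (-1) (normrN1 _).
rewrite (eq_esum (b := ((fun P => (f P)%:E)^\-)%E)); last first.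
  by move=> P _; rewrite funenegE mulN1r.
move=> ->.
rewrite (eq_esum (b := ((fun P => (f P)%:E)^\+)%E)); last first.
  by move=> P _; rewrite funeposE mul1r.
move=> ->; rewrite -EFinB; congr (_%:E); lra.
Qed.

End PathSums.

(** * The random walk matrix of a closure *)

Theorem proposition7 (R : realType) (n m : nat) (D : diagram)
    (b : braid_word (n + m)) :
  string_link n D ->
  isotopic (ups n) (ups n) D (closure_diagram b) ->
  let X := ulsubmx (burau b) in
  let Y := ursubmx (burau b) in
  let Z := dlsubmx (burau b) in
  let Q := drsubmx (burau b) in
  (1%:M - Q) \in unitmx /\
  is_random_walk_matrix R D (X + Y *m invmx (1%:M - Q) *m Z).
Proof.
move=> link iso X Y Z Q; have wf := link.1.
have uW := transfer_qt_unit R link.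
have [same_reach same_det] := isotopic_invariance qt_neq0 iso.
have uQ : 1%:M - Q \in unitmx.
  exact/closure_unit/(same_det.1 (unit_determined qt_neq0 wf uW)).
split=> //; set M := X + _.
have entryM i j : M j i = invmx (1%:M - transfer_mx qt (ups n) D)
    (rank (ups n) D (0%N, nat_of_ord i)) (rank (ups n) D (size D, nat_of_ord j)).
  have [] := (same_reach (upward (entries (delta_mx i 0)))
      (upward (entries (M *m delta_mx i 0))) _).2.
  - by rewrite orientations_upward size_entries.
  - exact: closure_reach.
  move=> T tr eT; rewrite -(output_entry qt_neq0 wf uW j tr eT).
  by rewrite -colE [RHS]mxE.
have [h [h_ge1 near_h]] := near1_contraction R link.
rewrite /is_random_walk_matrix; near=> t => i j.
have t_neq0 : t != 0 by apply/lt0r_neq0; near: t; exact: lt_nbhsr ltr01.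
have Uh : forall k, (edge_mx (passages (ups n) D) (rank (ups n) D \o source)
    (rank (ups n) D \o target) (fun q => `|weight t (ups n) D q|) *m h) k 0
    <= h k 0 / 2 by near: t; exact: near_h.
have W_le_U k l : `|transfer_mx t (ups n) D k l| <=
    edge_mx (passages (ups n) D) (rank (ups n) D \o source)
      (rank (ups n) D \o target) (fun q => `|weight t (ups n) D q|) k l.
  by rewrite !mxE ler_norm_sum.
have uWt := contraction_unit h_ge1 W_le_U Uh.
exists (invmx (1%:M - transfer_mx t (ups n) D)
    (rank (ups n) D (0%N, nat_of_ord i)) (rank (ups n) D (size D, nat_of_ord j))).
  by rewrite entryM; apply: mx_value_inv uWt _ _; exact: transfer_value.
have -> : paths D i j = [set P | is_walk (passages (ups n) D)
    (rank (ups n) D \o source) (rank (ups n) D \o target)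
    (rank (ups n) D (0%N, nat_of_ord i)) P
    (rank (ups n) D (size D, nat_of_ord j))]%classic.
  have botP : is_point (ups n) D (0%N, nat_of_ord i).
    by rewrite /is_point /= /level take0 size_nseq ltn_ord.
  have topP : is_point (ups n) D (size D, nat_of_ord j).
    by rewrite /is_point /= leqnn (well_formed_top wf) size_nseq ltn_ord.
  by apply/funext => P; rewrite /paths /mkset admissible_walk.
exact: (walks_has_sum _ _ (uniq_passages _ _) h_ge1 Uh).
Unshelve. all: by end_near. Qed.
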